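(* Let $\mathbb{G}$ be a stratified Lie group, let $\Omega,\Omega'\subset\mathbb{G}$ be open and let $\Phi:\Omega\to\Omega'$ be a diffeomorphism. The following are equivalent. (1) $\Phi$ is filtered for the standard filtration on $\mathbb{G}$ (restricted to $\Omega$ and $\Omega'$); (2) for all $x\in\Omega$, one has $(\Phi_* )_x(\mathfrak{g}_1^x)\subset\mathfrak{g}_1^{\Phi(x)}$; (3) for all $1\le k\le n_1$, $\Phi_*(X_k)$ is a section over $\Omega'$ of the bundle with fibers $\mathfrak{g}_1^{y}$; (4) there are smooth functions $p_{ij}:\Omega'\to\mathbb{R}$, $1\le i,j\le n_1$, such that, for all $1\le k\le n_1$, $\Phi_*(X_k)=\sum_{j=1}^{n_1}p_{kj}X_j$; (5) for all $1\le k\le n_1$, $\Phi_*(X_k)=\sum_{j=1}^{n_1}\big((X_k\Phi_j)\circ\Phi^{-1}\big)X_j$; (6) for all $x\in\Omega$, $J_\Phi(x)(F(x))\subset F(\Phi(x))$, where, for all $x\in\mathbb{G}$, $$F(x)=\bigcap_{i=n_1+1}^{d}\Big\{e_i-\sum_{j=1}^{n_1}a_{ji}(x)e_j\Big\}^{\perp}\subset\mathbb{R}^d.$$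
   Context: $\mathbb{G}$ is a $d$-dimensional stratified Lie group: connected, simply connected, with real nilpotent Lie algebra $\mathfrak{g}=\bigoplus_{n=1}^{\iota}\mathfrak{g}_n$, $[\mathfrak{g}_k,\mathfrak{g}_m]\subset\mathfrak{g}_{k+m}$, and $\mathfrak{g}_1$ generating $\mathfrak{g}$. $n_i=\dim\mathfrak{g}_i$. Fix a basis $Z_1,\dots,Z_d$ of $\mathfrak{g}$ adapted to the stratification (first a basis of $\mathfrak{g}_1$, then of $\mathfrak{g}_2$, etc.), regarded as left-invariant vector fields, and write $X_k=Z_k$ for $1\le k\le n_1$. Via the exponential map and this basis, $\mathbb{G}$ is identified with $\mathbb{R}^d$, with coordinates $x_1,\dots,x_d$ and standard basis $e_1,\dots,e_d$; $\Phi_j$ is the $j$-th coordinate of $\Phi$, and $J_\Phi(x)$ is its Jacobian matrix (acting on $\mathbb{R}^d$). In these coordinates, for $1\le j\le n_1$, $$X_j=\frac{\partial}{\partial x_j}+\sum_{i=n_1+1}^{d}a_{ji}\frac{\partial}{\partial x_i}$$ with polynomial functions $a_{ji}$ on $\mathbb G$. $\mathfrak{g}_n^x\subset T_x\mathbb{G}$ is the left translate of $\mathfrak{g}_n$ to $x$; in particular $\mathfrak{g}_1^x=\mathrm{Span}\{X_1|_x,\dots,X_{n_1}|_x\}$. The standard filtration on $\mathbb{G}$ is $H^n_x=\sum_{i=1}^n\mathfrak{g}_i^x$. A smooth map $\Phi$ between filtered manifolds with filtrations $(H^j)$, $(K^j)$ is filtered if $\Phi_*(H^j)\subset K^j$ for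 all $j\in\mathbb{N}$. The pushforward of a vector field $X$ along a diffeomorphism $\Phi$ is $\Phi_*(X)f=X(f\circ\Phi)\circ\Phi^{-1}$. *)

(* Defs.v *)
From HB Require Import structures.
From mathcomp Require Import all_boot all_order all_algebra.
From mathcomp Require Import all_classical all_reals all_analysis.

Set Implicit Arguments.
Unset Strict Implicit.
Unset Printing Implicit Defensive.

Import Order.TTheory GRing.Theory Num.Theory.
Import numFieldNormedType.Exports.

Local Open Scope classical_set_scope.
Local Open Scope ring_scope.

(* C^n and C^oo on U.  Meant for U open in a finite-dimensional space E, where
   the derivative is C^n iff it is so in every fixed direction v. *)
Fixpoint Cn_on (R : realType) (E F : normedModType R) (n : nat) (U : set E)
    (f : E -> F) : Prop :=
  match n with
  | 0 => forall x, U x -> {for x, continuous f}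
  | n'.+1 => (forall x, U x -> differentiable f x) /\
             forall v : E, Cn_on n' U (fun x => 'D_v f x)
  end.

Definition smooth_on (R : realType) (E F : normedModType R) (U : set E)
    (f : E -> F) : Prop := forall n, Cn_on n U f.

(* Maps between open subsets of R^d are represented by total functions whose
   values outside the domain are irrelevant; Psi plays the role of Phi^-1. *)
Definition diffeomorphism (R : realType) (d : nat) (U V : set 'rV[R]_d)
    (Phi Psi : 'rV[R]_d -> 'rV[R]_d) : Prop :=
  [/\ smooth_on U Phi, smooth_on V Psi,
      forall x, U x -> V (Phi x), forall y, V y -> U (Psi y) &
      (forall x, U x -> Psi (Phi x) = x) /\
      (forall y, V y -> Phi (Psi y) = y)].

Definition basis_vec (R : realType) (d : nat) (j : 'I_d) : 'rV[R]_d :=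
  delta_mx 0 j.

(* A vector field on R^d is given by its coefficients: X stands for the
   operator sum_i (X x)_i d/dx_i. *)
Definition vfield (R : realType) (d : nat) := 'rV[R]_d -> 'rV[R]_d.

Definition vf_act (R : realType) (d : nat) (X : vfield R d)
    (f : 'rV[R]_d -> R) : 'rV[R]_d -> R := fun x => 'D_(X x) f x.

(* The coefficients of the commutator XY - YX. *)
Definition vf_bracket (R : realType) (d : nat) (X Y : vfield R d) :
    vfield R d := fun x => 'D_(X x) Y x - 'D_(Y x) X x.

Definition tangent_map (R : realType) (d : nat)
    (Phi : 'rV[R]_d -> 'rV[R]_d) (x : 'rV[R]_d) : 'End('rV[R]_d) :=
  linfun ('d Phi x).

(* The operator f |-> X (f o Phi) o Phi^-1. *)
Definition vf_pushforward (R : realType) (d : nat)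
    (Phi Psi : 'rV[R]_d -> 'rV[R]_d) (X : vfield R d) (f : 'rV[R]_d -> R) :
    'rV[R]_d -> R := vf_act X (f \o Phi) \o Psi.

(* Equality over V of an operator D with the vector field Y. *)
Definition eq_vf_on (R : realType) (d : nat) (V : set 'rV[R]_d)
    (D : ('rV[R]_d -> R) -> 'rV[R]_d -> R) (Y : vfield R d) : Prop :=
  forall f, smooth_on V f -> forall y, V y -> D f y = vf_act Y f y.

(* A Lie group structure on R^d in exponential coordinates: the law is smooth
   and the lines t |-> t v are its one-parameter subgroups, that is, the
   exponential map is the identity of R^d = T_0.  A connected, simply connected
   Lie group with nilpotent Lie algebra takes this form once a basis of its Lie
   algebra is chosen. *)
Record exp_lie_group (R : realType) (d : nat) := ExpLieGroup {
  gmul : 'rV[R]_d -> 'rV[R]_d -> 'rV[R]_d;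
  gmul_smooth : smooth_on setT
    (fun p : ('rV[R]_d * 'rV[R]_d)%type => gmul p.1 p.2);
  gmulA : forall x y z, gmul x (gmul y z) = gmul (gmul x y) z;
  gmul0x : forall x, gmul 0 x = x;
  gmulx0 : forall x, gmul x 0 = x;
  gmulNx : forall x, gmul (- x) x = 0;
  gmulxN : forall x, gmul x (- x) = 0;
  gmul_exp : forall (v : 'rV[R]_d) (s t : R),
    gmul (s *: v) (t *: v) = (s + t) *: v }.

(* The left-invariant vector field with value v at the identity 0. *)
Definition left_inv (R : realType) (d : nat) (G : exp_lie_group R d)
    (v : 'rV[R]_d) : vfield R d := fun x => tangent_map (gmul G x) 0 v.

(* The Lie algebra is T_0 = R^d, identified with the left-invariant fields. *)
Definition lie_bracket (R : realType) (d : nat) (G : exp_lie_group R d)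
    (v w : 'rV[R]_d) : 'rV[R]_d := vf_bracket (left_inv G v) (left_inv G w) 0.

Definition graded_layer (R : realType) (d : nat) (wt : 'I_d -> nat) (n : nat) :
    {vspace 'rV[R]_d} := (\sum_(j < d | wt j == n) <[basis_vec R j]>)%VS.

(* wt j is the index of the layer containing the basis vector Z_j; it is
   nondecreasing because the basis lists g_1 first, then g_2, and so on.  The
   layers above the largest weight are zero, so the grading condition makes the
   Lie algebra nilpotent. *)
Record stratified_group (R : realType) (d : nat) := StratifiedGroup {
  sgroup :> exp_lie_group R d;
  wt : 'I_d -> nat;
  wt_gt0 : forall j, (0 < wt j)%N;
  wt_homo : {homo wt : i j / (i <= j)%N};
  layer_bracket : forall (k m : nat) (v w : 'rV[R]_d),
    v \in graded_layer R wt k -> w \in graded_layer R wt m ->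
    lie_bracket sgroup v w \in graded_layer R wt (k + m);
  layer1_generates : forall V : {vspace 'rV[R]_d},
    (graded_layer R wt 1 <= V)%VS ->
    (forall v w, v \in V -> w \in V -> lie_bracket sgroup v w \in V) ->
    V = fullv }.

Section StratifiedGroup.
Context (R : realType) (d : nat) (G : stratified_group R d).

(* In the 1-based numbering of the basis: k <= n_1. *)
Definition horizontal (k : 'I_d) : bool := wt G k == 1%N.

Definition Zfield (j : 'I_d) : vfield R d := left_inv G (basis_vec R j).

(* g_n^x, the image of g_n under the differential of left translation by x. *)
Definition layer_at (n : nat) (x : 'rV[R]_d) : {vspace 'rV[R]_d} :=
  (tangent_map (gmul G x) 0 @: graded_layer R (wt G) n)%VS.

Definition std_filtration (n : nat) (x : 'rV[R]_d) : {vspace 'rV[R]_d} :=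
  (\sum_(1 <= i < n.+1) layer_at i x)%VS.

Definition is_layer1_section (V : set 'rV[R]_d) (Y : vfield R d) : Prop :=
  smooth_on V Y /\ forall y, V y -> Y y \in layer_at 1 y.

(* a_{ji}, the coefficient of d/dx_i in Z_j. *)
Definition Zcoef (j i : 'I_d) (x : 'rV[R]_d) : R := Zfield j x 0 i.

Definition orth (u : 'rV[R]_d) : set 'rV[R]_d :=
  [set v | \sum_(i < d) v 0 i * u 0 i = 0].

Definition Fspace (x : 'rV[R]_d) : set 'rV[R]_d :=
  \bigcap_(i in [set i : 'I_d | ~~ horizontal i])
    orth (basis_vec R i
          - \sum_(j < d | horizontal j) Zcoef j i x *: basis_vec R j).

End StratifiedGroup.

Definition filtered_map (R : realType) (d : nat)
    (H K : nat -> 'rV[R]_d -> {vspace 'rV[R]_d}) (U : set 'rV[R]_d)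
    (Phi : 'rV[R]_d -> 'rV[R]_d) : Prop :=
  forall (n : nat) (x : 'rV[R]_d), U x ->
    (tangent_map Phi x @: H n x <= K n (Phi x))%VS.

(* Main.v *)
Require Import Defs.
From HB Require Import structures.
From mathcomp Require Import all_boot all_order all_algebra.
From mathcomp Require Import all_classical all_reals all_analysis.
From mathcomp Require Import zify ring lra.

Import Order.TTheory GRing.Theory Num.Theory.
Import numFieldNormedType.Exports.

Set Implicit Arguments.
Unset Strict Implicit.
Unset Printing Implicit Defensive.

Local Open Scope classical_set_scope.
Local Open Scope ring_scope.

(** Every condition except the first one says, pointwise, that the differential
    of Phi maps the horizontal layer at x into the horizontal layer at Phi x.
    Two facts make this translation possible.

    The first concerns the exponential coordinates.  A coordinate function i of
    weight 1 vanishes on all brackets, so it is a character of the Lie algebra;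
    it is therefore also a homomorphism of the group, and the left-invariant
    fields have constant i-th coefficient [maurer_cartan_character].  Hence the
    horizontal coefficients of Z_j are those of e_j, a vector v of the
    horizontal layer at x is the sum of the v_j Z_j(x) [layer1_expand], and
    F(x) is the horizontal layer at x [Fspace_layer1].  The passage from the
    algebra to the group does not go through the Baker-Campbell-Hausdorff
    formula.  The derivative of y |-> (-(t x)) (t y) at y = x is, for t = 1,
    the left translation of tangent vectors at x back to the identity; its i-th
    coordinate is an additive function of t, so it is linear in t, and it can
    be computed from its behaviour at t = 0.

    The second concerns vector fields: a derivation is determined by its values
    on the coordinates, so the operator Phi_* X is the vector field
    y |-> d Phi (X) taken at Psi y [eq_vf_pushforwardP], which is smooth with X
    [smooth_pushfield].  With these facts all the conditions but the first
    follow from one another by comparing coefficients.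

    The remaining implication, that horizontality implies that Phi is filtered,
    is where stratification enters [horizontal_filtered].  Pushing forward
    commutes with brackets [pushfield_bracket], and the bracket of a section of
    H^a and a section of H^b is a section of H^(a+b)
    [std_filtration_bracket].  So the vectors v all of whose components v_n
    satisfy Phi_* X_{v_n} in H^n form a Lie subalgebra; it contains the first
    layer, hence is everything.  Both bracket statements rest on the symmetry of
    second derivatives [schwarz]. *)

(** * Derivatives and maps of class C^n *)

Section Calculus.
Context {R : realType}.
Implicit Types E F : normedModType R.

Lemma is_diff_near E F (f g : E -> F) (x : E) (df : E -> F) :
  (\near x, f x = g x) -> is_diff x f df -> is_diff x g df.
Proof.
move=> fg [dfx <-].
have fgx : f x = g x by exact: nbhs_singleton fg.
have [cdf fE] := (diff_locallyP x f).1 dfx.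
have gE : g \o shift x = cst (g x) + 'd f x +o_ 0 id.
  apply/eqaddoP => _/posnumP[e].
  move/eqaddoP: fE => /(_ _ [gt0 of e%:num]).
  have fg0 : \forall h \near 0, f (h + x) = g (h + x).
    have sx : h + x @[h --> 0] --> x.
      rewrite -[X in _ --> X]add0r.
      by apply: cvgD; [exact: cvg_id|exact: cvg_cst].
    exact: sx _ fg.
  move: fg0; apply: filterS2 => h /= fgh.
  by rewrite !fctE /= -fgh -fgx.
have dg := diff_unique cdf gE.
have gx : differentiable g x by apply/diff_locallyP; rewrite dg.
by split; [exact: gx | exact: dg].
Qed.

Lemma is_diff_eqfun E F (f g df dg : E -> F) (x : E) :
  f =1 g -> df =1 dg -> is_diff x f df -> is_diff x g dg.
Proof. by move=> /funext -> /funext ->. Qed.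

Lemma is_diff_fun_unique E F (f df dg : E -> F) (x : E) :
  is_diff x f df -> is_diff x f dg -> df =1 dg.
Proof. by move=> [_ h] [_ k] y; rewrite -h -k. Qed.

Lemma is_diff_deriveE E F (f df : E -> F) x v :
  is_diff x f df -> 'D_v f x = df v.
Proof. by move=> [h <-]; rewrite deriveE. Qed.

(** The product rule for scalar multiplication, as the derivative of a
    continuous bilinear map. *)
Lemma is_diff_scale E F (k : E -> R) (f : E -> F) x
    (dk : E -> R) (df : E -> F) :
  is_diff x k dk -> is_diff x f df ->
  is_diff x (fun y => k y *: f y) (fun v => k x *: df v + dk v *: f x).
Proof.
move=> kx fx.
have bil : bilinear_for (GRing.Scale.Law.clone _ _ *:%R _)
    (GRing.Scale.Law.clone _ _ *:%R _) (fun (a : R) (v : F) => a *: v).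
  split=> [v|a] b u w /=; first by rewrite scalerDl scalerA.
  by rewrite scalerDr !scalerA mulrC.
pose BM := bilinear_isBilinear.Build R R F F _ _ _ bil.
pose B : {bilinear R -> F -> F} := HB.pack (fun (a : R) (v : F) => a *: v) BM.
have cB : continuous (fun p : R * F => B p.1 p.2).
  by move=> p; exact: scale_continuous.
have dB (p : R * F) : is_diff p (fun p : R * F => B p.1 p.2)
     (fun q => B p.1 q.2 + B q.1 p.2).
  by apply: DiffDef; [exact: differentiable_bilin|exact: diff_bilin].
exact: (is_diff_comp (is_diff_pair kx fx) (dB (k x, f x))).
Qed.

Lemma is_diff_linear E F (L : {linear E -> F}) x :
  continuous L -> is_diff x L L.
Proof.
move=> cL; apply: DiffDef; first exact/linear_differentiable.
by rewrite diff_lin.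
Qed.

Lemma Cn_on_ext E F n (U : set E) (f g : E -> F) : open U ->
  (forall x, U x -> f x = g x) -> Cn_on n U f -> Cn_on n U g.
Proof.
move=> oU; elim: n f g => [|n IH] f g fg /=.
  move=> cf x Ux; have h := cf x Ux.
  change (g y @[y --> x] --> g x); rewrite -(fg x Ux); apply: cvg_trans h.
  apply: near_eq_cvg; near=> y; apply/fg.
  by near: y; exact: open_nbhs_nbhs.
move=> [df Df]; have fgn x : U x -> \near x, f x = g x.
  by move=> Ux; near=> y; apply: fg; near: y; exact: open_nbhs_nbhs.
split.
  move=> x Ux.
  by have [] := is_diff_near (fgn x Ux) (differentiableP (df x Ux)).
move=> v; apply: IH (Df v) => x Ux.
by apply: near_eq_derive; exact: fgn.
Unshelve. all: by end_near. Qed.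

Lemma Cn_on_pred E F n (U : set E) (f : E -> F) :
  Cn_on n.+1 U f -> Cn_on n U f.
Proof.
elim: n f => [|n IH] f [df Df].
  by move=> x Ux; exact: differentiable_continuous (df x Ux).
by split => // v; apply: IH.
Qed.

Lemma Cn_on_subset E F n (U V : set E) (f : E -> F) :
  U `<=` V -> Cn_on n V f -> Cn_on n U f.
Proof.
move=> UV; elim: n f => [|n IH] f /=; first by move=> h x /UV; exact: h.
by move=> [h1 h2]; split=> [x /UV|v]; [exact: h1|apply: IH].
Qed.

Lemma Cn_on_cst E F n (U : set E) (c : F) : Cn_on n U (fun _ : E => c).
Proof.
elim: n c => [|n IH] c /=; first by move=> x _; exact: cst_continuous.
split; first by move=> x _; exact: (differentiable_cst c).
move=> v; have -> : (fun x : E => 'D_v (fun=> c) x) = (fun=> 0).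
  by apply/funext => x; exact: derive_cst.
exact: IH.
Qed.

Lemma Cn_on_add E F n (U : set E) (f g : E -> F) : open U ->
  Cn_on n U f -> Cn_on n U g -> Cn_on n U (fun x => f x + g x).
Proof.
move=> oU; elim: n f g => [|n IH] f g /=.
  by move=> hf hg x Ux; apply: continuousD; [exact: hf|exact: hg].
move=> [df Df] [dg Dg]; split.
  by move=> x Ux; apply: differentiableD; [exact: df|exact: dg].
move=> v; apply: Cn_on_ext (IH _ _ (Df v) (Dg v)) => // x Ux.
by rewrite deriveD//; apply: diff_derivable; [exact: df|exact: dg].
Qed.

Lemma Cn_on_sum E F n (U : set E) (I : Type) (r : seq I) (P : pred I)
    (f : I -> E -> F) : open U -> (forall i, P i -> Cn_on n U (f i)) ->
  Cn_on n U (fun x => \sum_(i <- r | P i) f i x).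
Proof.
move=> oU fU; elim: r => [|i r IH].
  have -> : (fun x => \sum_(i <- [::] | P i) f i x) = (fun=> 0).
    by apply/funext => x; rewrite big_nil.
  exact: Cn_on_cst.
have -> : (fun x => \sum_(j <- i :: r | P j) f j x) =
    (fun x => (if P i then f i x else 0) + \sum_(j <- r | P j) f j x).
  by apply/funext => x; rewrite big_cons; case: ifP; rewrite ?add0r.
by apply: Cn_on_add => //; case Pi: (P i); [exact: fU|exact: Cn_on_cst].
Qed.

(** By induction on n: the derivative of a product is a sum of two products
    whose factors are of class C^n, so the hypothesis at n, not only at n+1, is
    needed for the undifferentiated factors. *)
Lemma Cn_on_scale E F n (U : set E) (k : E -> R) (f : E -> F) : open U ->
  Cn_on n U k -> Cn_on n U f -> Cn_on n U (fun x => k x *: f x).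
Proof.
move=> oU; elim: n k f => [|n IH] k f.
  by move=> hk hf x Ux; apply: continuousZ; [exact: hk|exact: hf].
move=> hk hf; have hk1 := Cn_on_pred hk; have hf1 := Cn_on_pred hf.
case: hk hf => [dk Dk] [df Df].
have dkf x : U x -> is_diff x (fun y => k y *: f y)
    (fun v => k x *: 'd f x v + 'd k x v *: f x).
  move=> Ux; apply: is_diff_scale; apply: differentiableP; first exact: dk.
  exact: df.
rewrite /=; split; first by move=> x /dkf [].
move=> v.
apply: (Cn_on_ext (f := fun x => k x *: 'D_v f x + 'D_v k x *: f x)) => //.
  move=> x Ux; rewrite (is_diff_deriveE _ (dkf x Ux)).
  by rewrite !deriveE//; [exact: dk|exact: df].
exact: (Cn_on_add oU (IH _ _ hk1 (Df v)) (IH _ _ (Dk v) hf1)).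
Qed.

Lemma Cn_on_linl E F F' n (U : set E) (L : {linear F -> F'}) (f : E -> F) :
  open U -> continuous L -> Cn_on n U f -> Cn_on n U (fun x => L (f x)).
Proof.
move=> oU cL; elim: n f => [|n IH] f /=.
  move=> hf x Ux; apply: (continuous_comp (f := f) (g := L)); first exact: hf.
  exact: cL.
move=> [df Df].
have dLf x : U x -> is_diff x (fun y => L (f y)) (fun v => L ('d f x v)).
  move=> Ux; apply: (is_diff_comp (differentiableP (df x Ux))).
  exact: is_diff_linear.
split; first by move=> x /dLf [].
move=> v; apply: Cn_on_ext (IH _ (Df v)) => // x Ux.
by rewrite (is_diff_deriveE _ (dLf x Ux)) deriveE//; exact: df.
Qed.

(** For a general inner function the chain rule produces sums over a basis of
    the middle space; for an affine one the derivative in direction v is again a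
    composition with the same map, so the middle space may be arbitrary. This is
    what handles the partial maps of the product of a group, defined on pairs of
    vectors. *)
Lemma Cn_on_affine E E' F n (U : set E) (V : set E') (A : {linear E -> E'})
    (c : E') (f : E' -> F) :
  open U -> continuous A -> (forall x, U x -> V (A x + c)) ->
  Cn_on n V f -> Cn_on n U (fun x => f (A x + c)).
Proof.
move=> oU cA UV.
have dA x : is_diff x (fun y => A y + c) A.
  have h := is_diffD (is_diff_linear x cA) (is_diff_cst c x).
  by apply: is_diff_eqfun h => // y; exact: addr0.
elim: n f => [|n IH] f.
  move=> hf x Ux; apply: (continuous_comp (f := fun y => A y + c) (g := f)).
    by have [h _] := dA x; exact: differentiable_continuous.
  exact/hf/UV.
move=> [df Df].
have dfA x : U x ->
    is_diff x (fun y => f (A y + c)) (fun v => 'd f (A x + c) (A v)).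
  move=> Ux; apply: (is_diff_comp (dA x)).
  exact/differentiableP/df/UV.
rewrite /=; split; first by move=> x /dfA [].
move=> v; apply: Cn_on_ext (IH _ (Df (A v))) => // x Ux.
by rewrite (is_diff_deriveE _ (dfA x Ux)) deriveE//; exact/df/UV.
Qed.

End Calculus.

(** * Coordinates, and the symmetry of second derivatives *)

Section Coordinates.
Context {R : realType}.
Implicit Types E F : normedModType R.

(** A name for the coordinate, so that it can carry a linear structure. *)
Definition row_coord d (i : 'I_d) (v : 'rV[R]_d) : R := v 0 i.

Fact row_coord_is_linear d (i : 'I_d) : linear (row_coord i).
Proof. by move=> a u v; rewrite /row_coord !mxE. Qed.

HB.instance Definition _ d (i : 'I_d) :=
  GRing.isLinear.Build R 'rV[R]_d R *%R (row_coord i) (row_coord_is_linear i).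

Lemma row_coord_continuous d (i : 'I_d) : continuous (row_coord i).
Proof. exact: coord_continuous. Qed.

Lemma linear_rowE d F (L : {linear 'rV[R]_d -> F}) (v : 'rV[R]_d) :
  L v = \sum_(i < d) v 0 i *: L (basis_vec R i).
Proof.
transitivity (L (\sum_(i < d) v 0 i *: basis_vec R i)).
  by congr (L _); exact: row_sum_delta.
rewrite linear_sum; apply: eq_bigr => i _; exact: linearZ_LR.
Qed.

Lemma is_diff_coord E d (f df : E -> 'rV[R]_d) x i :
  is_diff x f df -> is_diff x (fun y => f y 0 i) (fun v => df v 0 i).
Proof.
move=> fx.
exact: (is_diff_comp fx (is_diff_linear (f x) (@row_coord_continuous _ i))).
Qed.

Lemma derive_coord E d (f : E -> 'rV[R]_d) x v i : differentiable f x ->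
  'D_v (fun y => f y 0 i) x = ('D_v f x) 0 i.
Proof.
move=> /differentiableP fx; rewrite (is_diff_deriveE _ (is_diff_coord i fx)).
by rewrite (is_diff_deriveE _ fx).
Qed.

Lemma Cn_on_coord E d n (U : set E) (f : E -> 'rV[R]_d) i : open U ->
  Cn_on n U f -> Cn_on n U (fun y => f y 0 i).
Proof.
move=> oU fU; exact: (Cn_on_linl oU (@row_coord_continuous _ i) fU).
Qed.

(** The derivative of the composite in direction v is the combination of the
    partial derivatives of g at f x with the coefficients of 'D_v f x; each term
    is a product of a C^n function and a composite with a C^n outer function, to
    which the induction hypothesis applies. *)
Lemma Cn_on_comp E F d n (U : set E) (V : set 'rV[R]_d)
    (f : E -> 'rV[R]_d) (g : 'rV[R]_d -> F) :
  open U -> (forall x, U x -> V (f x)) -> Cn_on n U f -> Cn_on n V g ->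
  Cn_on n U (fun x => g (f x)).
Proof.
move=> oU UV; elim: n g => [|n IH] g.
  move=> hf hg x Ux; apply: (continuous_comp (f := f) (g := g)).
    exact: hf.
  exact/hg/UV.
move=> hf hg; have hf1 := Cn_on_pred hf.
case: hf hg => [df Df] [dg Dg].
have dgf x : U x ->
    is_diff x (fun y => g (f y)) (fun v => 'd g (f x) ('d f x v)).
  move=> Ux; apply: (is_diff_comp (differentiableP (df x Ux))).
  exact/differentiableP/dg/UV.
rewrite /=; split; first by move=> x /dgf [].
move=> v; apply: (Cn_on_ext (f := fun x => \sum_(i < d)
    ('D_v f x) 0 i *: 'D_(basis_vec R i) g (f x))) => //.
  move=> x Ux; rewrite (is_diff_deriveE _ (dgf x Ux)) deriveE; last exact: df.
  rewrite [RHS]linear_rowE; apply: eq_bigr => i _; rewrite deriveE//.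
  exact/dg/UV.
apply: Cn_on_sum => // i _; apply: Cn_on_scale => //.
  exact/Cn_on_coord/Df.
exact: (IH _ hf1 (Dg _)).
Qed.

Lemma is_diff_line E (a v : E) (s : R) :
  is_diff s (fun s => a + s *: v) (fun s => s *: v).
Proof.
have h : is_diff s (fun s : R => s *: v) (fun s => s *: v).
  exact: is_diff_scalel.
have := is_diffD (is_diff_cst a s) h.
by congr is_diff_def; apply/funext => y; rewrite !fctE// add0r.
Qed.

Lemma derive_line E F (f : E -> F) (a v : E) s :
  differentiable f (a + s *: v) ->
  is_derive s 1 (fun s => f (a + s *: v)) ('D_v f (a + s *: v)).
Proof.
move=> /differentiableP fd.
have h := is_diff_comp (is_diff_line a v s) fd.
split; first by case: h => h _; exact: diff_derivable.
by rewrite (is_diff_deriveE _ h) /= scale1r (is_diff_deriveE _ fd).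
Qed.

Lemma mean_value_line E (f : E -> R) (a v : E) (h : R) : 0 < h ->
  (forall s, 0 <= s <= h -> differentiable f (a + s *: v)) ->
  exists2 c, 0 < c < h & f (a + h *: v) - f a = h * 'D_v f (a + c *: v).
Proof.
move=> h0 df.
have [|||c] := @MVT R (fun s => f (a + s *: v))
  (fun s => 'D_v f (a + s *: v)) 0 h => //.
- move=> s; rewrite in_itv/= => /andP[s0 sh]; apply/derive_line/df.
  by rewrite !ltW.
- apply: derivable_within_continuous => s; rewrite in_itv/= => sh.
  by have [] := derive_line (df s sh).
- rewrite in_itv/= scale0r addr0 subr0 mulrC => ch ->.
  by exists c.
Qed.

Lemma near_plane E (x v w : E) (P : set E) : (\forall y \near x, P y) ->
  exists2 h : R, 0 < h & forall s t, 0 <= s <= h -> 0 <= t <= h ->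
    P (x + s *: v + t *: w).
Proof.
move=> /nbhs_ballP[e /= e0 eP].
have k0 : 0 < `|v| + `|w| + 1 by rewrite ltr_wpDl ?addr_ge0.
exists (e / 2 / (`|v| + `|w| + 1)); first by rewrite !divr_gt0.
move=> s t /andP[s0 sh] /andP[t0 th]; apply: eP.
rewrite -ball_normE /= -addrA opprD addNKr normrN.
apply: (@le_lt_trans _ _ (e / 2)); last first.
  by rewrite ltr_pdivrMr// ltr_pMr// ltr1n.
apply: le_trans (ler_normD _ _) _; rewrite !normrZ !ger0_norm//.
move: sh th; rewrite !ler_pdivlMr// => sh th.
have v0 := normr_ge0 v; have w0 := normr_ge0 w.
set a := `|v| in sh th v0 k0 *; set b := `|w| in sh th w0 k0 *.
have [st|/ltW ts] := leP s t.
  have sa : s * a <= t * a by rewrite ler_wpM2r.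
  by apply: le_trans th; rewrite !mulrDr mulr1; lra.
have tb : t * b <= s * b by rewrite ler_wpM2r.
by apply: le_trans sh; rewrite !mulrDr mulr1; lra.
Qed.

(** The mean value theorem applied twice: to y |-> f (y + h w) - f y along v,
    then to 'D_v f along w. The left-hand side is symmetric in v and w, the
    right-hand side tends to the mixed derivative. *)
Lemma second_difference E (f : E -> R) (x v w : E) (h : R) : 0 < h ->
  (forall s t, 0 <= s <= h -> 0 <= t <= h ->
     differentiable f (x + s *: v + t *: w)) ->
  (forall s t, 0 <= s <= h -> 0 <= t <= h ->
     differentiable ('D_v f) (x + s *: v + t *: w)) ->
  exists s t, [/\ 0 <= s <= h, 0 <= t <= h &
    f (x + h *: v + h *: w) - f (x + h *: w) - (f (x + h *: v) - f x) =
    h * (h * 'D_w ('D_v f) (x + s *: v + t *: w))].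
Proof.
move=> h0 df ddf.
have hh : 0 <= h <= h by rewrite ltW ?lexx.
have h00 : 0 <= (0 : R) <= h.
  by apply/andP; split; [exact: lexx|exact: ltW].
pose g (y : E) := f (y + h *: w) - f y.
have dg s : 0 <= s <= h -> is_diff (x + s *: v) g
    (fun u => 'd f (x + s *: v + h *: w) u - 'd f (x + s *: v) u).
  move=> sh.
  have d1 := differentiableP (df s h sh hh).
  have d2 := differentiableP (df s 0 sh h00); rewrite scale0r addr0 in d2.
  have dt : is_diff (x + s *: v) (fun y => y + h *: w) id.
    have := is_diffD (is_diff_id (x + s *: v))
      (is_diff_cst (h *: w) (x + s *: v)).
    by congr is_diff_def; apply/funext => y; rewrite !fctE// addr0.
  exact: (is_diffB (is_diff_comp dt d1) d2).
have [|c /andP[c0 ch] gE] := @mean_value_line _ g x v h h0.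
  by move=> s /dg [].
have cc : 0 <= c <= h by rewrite !ltW.
have [|t /andP[t0 th] ggE] := @mean_value_line _ ('D_v f) (x + c *: v) w h h0.
  by move=> t th; exact: ddf.
exists c, t; split => //; first by rewrite !ltW.
have df0 := df c 0 cc h00; rewrite scale0r addr0 in df0.
rewrite -ggE (deriveE _ (df c h cc hh)) (deriveE _ df0).
move: gE; rewrite (is_diff_deriveE _ (dg c cc)) /g => <-.
by ring.
Qed.

Lemma scalar_schwarz E (f : E -> R) (U : set E) x v w : open U -> U x ->
  Cn_on 2 U f -> 'D_v ('D_w f) x = 'D_w ('D_v f) x.
Proof.
move=> oU Ux [df Df].
apply/eqP; rewrite -subr_eq0 -normr_le0; apply/ler_addgt0Pl => e e0.
have [dv DDv] := Df v; have [dw DDw] := Df w.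
have e2 : 0 < e / 2 by rewrite divr_gt0.
have cv : \forall y \near x, `|'D_w ('D_v f) x - 'D_w ('D_v f) y| < e / 2.
  by have /cvgrPdist_lt := DDv w x Ux; apply.
have cw : \forall y \near x, `|'D_v ('D_w f) x - 'D_v ('D_w f) y| < e / 2.
  by have /cvgrPdist_lt := DDw v x Ux; apply.
have nU : \forall y \near x, U y by exact: open_nbhs_nbhs.
have [h1 h10 P1] := near_plane v w (filterI nU (filterI cv cw)).
have [h2 h20 P2] := near_plane w v (filterI nU (filterI cv cw)).
pose h := Num.min h1 h2.
have h0 : 0 < h by rewrite lt_min h10.
have le1 s : 0 <= s <= h -> 0 <= s <= h1 by rewrite le_min => /andP[-> /andP[]].
have le2 s : 0 <= s <= h -> 0 <= s <= h2 by rewrite le_min => /andP[-> /andP[]].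
have [||s [t [sh th E1]]] := @second_difference _ f x v w h h0.
- by move=> s t sh th; have [/df] := P1 s t (le1 s sh) (le1 t th).
- by move=> s t sh th; have [/dv] := P1 s t (le1 s sh) (le1 t th).
have [||s' [t' [sh' th' E2]]] := @second_difference _ f x w v h h0.
- by move=> a b sa sb; have [/df] := P2 a b (le2 a sa) (le2 b sb).
- by move=> a b sa sb; have [/dw] := P2 a b (le2 a sa) (le2 b sb).
have E3 : 'D_w ('D_v f) (x + s *: v + t *: w) =
    'D_v ('D_w f) (x + s' *: w + t' *: v).
  have hn0 : h != 0 by rewrite gt_eqF.
  have : h * (h * 'D_w ('D_v f) (x + s *: v + t *: w)) =
      h * (h * 'D_v ('D_w f) (x + s' *: w + t' *: v)).
    apply: etrans (esym E1) (etrans _ E2).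
    by rewrite [x + h *: w + _]addrAC; ring.
  move: ('D_w _ _) ('D_v _ _) => p q.
  by move/(mulfI hn0)/(mulfI hn0).
have [_ [A1 _]] := P1 s t (le1 s sh) (le1 t th).
have [_ [_ A2]] := P2 s' t' (le2 s' sh') (le2 t' th').
move: A1 A2; rewrite E3 addr0 => {E1 E2 E3}.
move: ('D_v ('D_w f) x) ('D_w ('D_v f) x) ('D_v ('D_w f) _) => p q r A1 A2.
have -> : p - q = (p - r) - (q - r) by ring.
by rewrite (splitr e) (le_trans (ler_normB _ _))// lerD// ltW.
Qed.

Lemma schwarz E d (f : E -> 'rV[R]_d) (U : set E) x v w : open U -> U x ->
  Cn_on 2 U f -> 'D_v ('D_w f) x = 'D_w ('D_v f) x.
Proof.
move=> oU Ux fU; apply/rowP => i.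
have [df Df] := fU; have [dv _] := Df v; have [dw _] := Df w.
have Dcoord u u' : (forall y, U y -> differentiable ('D_u f) y) ->
    ('D_u' ('D_u f) x) 0 i = 'D_u' ('D_u (fun y => f y 0 i)) x.
  move=> du; rewrite -derive_coord; last exact: du.
  apply: near_eq_derive; near=> y; rewrite derive_coord//.
  by apply: df; near: y; exact: open_nbhs_nbhs.
apply: etrans (Dcoord w v dw) (etrans _ (esym (Dcoord v w dv))).
exact: (scalar_schwarz v w oU Ux (Cn_on_coord i oU fU)).
Unshelve. all: by end_near. Qed.

End Coordinates.

(** * Homogeneous functions *)

Section Homogeneous.
Context {R : realType}.
Implicit Types E F : normedModType R.

(** The difference quotient of f at 0 along v is constant, equal to f v, on the
    sequence h = 1/(n+1). This turns homogeneity under the positive integers,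
    which can be read off a group law, into linearity. *)
Lemma homogeneous_eq_derive E F (f : E -> F) (v : E) :
  differentiable f 0 -> f 0 = 0 ->
  (forall n, f v = n.+1%:R *: f (n.+1%:R^-1 *: v)) -> f v = 'D_v f 0.
Proof.
move=> df f0 fn.
have /cvg_ex[l fl] := @diff_derivable _ _ _ f 0 v df.
have hs : (fun n => n.+1%:R^-1 : R) @ \oo --> 0^'.
  have h0 : (fun n => n.+1%:R^-1 : R) @ \oo --> (0 : R) by exact: cvg_harmonic.
  move=> A /h0 /=; rewrite /nbhs /= => hA; near=> n.
  have : n.+1%:R^-1 != 0 :> R by rewrite invr_eq0 pnatr_eq0.
  by near: n.
have lE : l = 'D_v f 0 by apply/esym/cvg_lim.
have := cvg_comp _ _ hs fl; rewrite -lE.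
have -> : (fun h => h^-1 *: ((f \o shift 0) (h *: v) - f 0)) \o
    (fun n => n.+1%:R^-1) = (fun=> f v).
  by apply/funext => n /=; rewrite invrK f0 subr0 addr0 -fn.
by move=> h; apply: (cvg_unique _ _ h) => //; exact: cvg_cst.
Unshelve. all: by end_near. Qed.

End Homogeneous.

(** * Differentiating the group law *)

Section LeftTranslations.
Context {R : realType} {d : nat} (G : exp_lie_group R d).
Local Notation V := 'rV[R]_d.
Local Notation m := (gmul G).
Implicit Types (x y z v w : V).

Definition gmul_pair (p : V * V) : V := m p.1 p.2.

(** The differential of the product at (x, y), in the directions u and v.  The
    left-invariant field of v is its value at y = 0 and u = 0. *)
Definition dgmul x y u v : V := 'd gmul_pair (x, y) (u, v).

Lemma is_diff_gmul_pair x y :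
  is_diff (x, y) gmul_pair (fun p => dgmul x y p.1 p.2).
Proof.
have [h _] := gmul_smooth G 1.
have := differentiableP (h (x, y) I).
by apply: is_diff_eqfun => // -[u v].
Qed.

Lemma dgmulD x y u v : dgmul x y u v = dgmul x y u 0 + dgmul x y 0 v.
Proof.
rewrite /dgmul -linearD /=; congr ('d _ _ _).
by rewrite -[RHS]/(u + 0, 0 + v) addr0 add0r.
Qed.

Lemma dgmul0Z x y a v : dgmul x y 0 (a *: v) = a *: dgmul x y 0 v.
Proof.
by rewrite /dgmul -linearZ_LR /=; congr ('d _ _ _);
  rewrite -[RHS]/(a *: 0, a *: v) scaler0.
Qed.

Lemma dgmulZ0 x y a u : dgmul x y (a *: u) 0 = a *: dgmul x y u 0.
Proof.
by rewrite /dgmul -linearZ_LR /=; congr ('d _ _ _);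
  rewrite -[RHS]/(a *: u, a *: 0) scaler0.
Qed.

Lemma dgmul0N x y v : dgmul x y 0 (- v) = - dgmul x y 0 v.
Proof. by rewrite -scaleN1r dgmul0Z scaleN1r. Qed.

Lemma is_diff_gmul (E : normedModType R) (f g df dg : E -> V) t :
  is_diff t f df -> is_diff t g dg ->
  is_diff t (fun s => m (f s) (g s)) (fun u => dgmul (f t) (g t) (df u) (dg u)).
Proof.
move=> hf hg.
exact: (is_diff_comp (is_diff_pair hf hg) (is_diff_gmul_pair (f t) (g t))).
Qed.

Lemma dgmul_x0 x u : dgmul x 0 u 0 = u.
Proof.
have h := is_diff_gmul (is_diff_id x) (is_diff_cst 0 x).
have h' : is_diff x (fun s => m s 0) id.
  by apply: is_diff_eqfun (is_diff_id x) => // y; rewrite gmulx0.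
exact: (is_diff_fun_unique h h' u).
Qed.

Lemma dgmul_0x y v : dgmul 0 y 0 v = v.
Proof.
have h := is_diff_gmul (is_diff_cst 0 y) (is_diff_id y).
have h' : is_diff y (fun s => m 0 s) id.
  by apply: is_diff_eqfun (is_diff_id y) => // z; rewrite gmul0x.
exact: (is_diff_fun_unique h h' v).
Qed.

Lemma is_diff_ltrans x y : is_diff y (m x) (dgmul x y 0).
Proof. exact: (is_diff_gmul (is_diff_cst x y) (is_diff_id y)). Qed.

Lemma tangent_ltransE x y v : tangent_map (m x) y v = dgmul x y 0 v.
Proof.
by rewrite /tangent_map lfunE /=; case: (is_diff_ltrans x y) => _ ->.
Qed.

Lemma left_invE v x : left_inv G v x = dgmul x 0 0 v.
Proof. exact: tangent_ltransE. Qed.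

Lemma left_invD v w x : left_inv G (v + w) x = left_inv G v x + left_inv G w x.
Proof. exact: linearD. Qed.

Lemma left_invZ a v x : left_inv G (a *: v) x = a *: left_inv G v x.
Proof. exact: linearZ. Qed.

Lemma left_inv0 v : left_inv G v 0 = v.
Proof. by rewrite left_invE dgmul_0x. Qed.

(** The line through v is a one-parameter subgroup, that is, an integral curve
    of the left-invariant field of v. *)
Lemma left_inv_radial v t : left_inv G v (t *: v) = v.
Proof.
have h1 : is_diff (0 : R) (fun s : R => s *: v) (fun s => s *: v).
  exact: is_diff_scalel.
have h2 := is_diff_ltrans (t *: v) (0 *: v).
have h := is_diff_comp h1 h2.
have h' : is_diff (0 : R) (m (t *: v) \o *:%R^~ v) (fun s => s *: v).
  apply: is_diff_eqfun (is_diff_line (t *: v) v 0) => // s /=.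
  by rewrite gmul_exp scalerDl.
by have := is_diff_fun_unique h h' 1; rewrite /= !scale1r scale0r -left_invE.
Qed.

(* The two partial maps of the product are composites with these inclusions. *)
Fact pair_inl_is_linear : linear (fun x : V => (x, 0) : V * V).
Proof.
by move=> a x y; rewrite -[RHS]/(a *: x + y, a *: 0 + 0) scaler0 addr0.
Qed.

Fact pair_inr_is_linear : linear (fun x : V => (0, x) : V * V).
Proof.
by move=> a x y; rewrite -[RHS]/(a *: 0 + 0, a *: x + y) scaler0 addr0.
Qed.

Definition pair_inl : {linear V -> (V * V)%type} :=
  HB.pack (fun x : V => (x, 0) : V * V)
  (GRing.isLinear.Build R V (V * V)%type *:%R _ pair_inl_is_linear).

Definition pair_inr : {linear V -> (V * V)%type} :=
  HB.pack (fun x : V => (0, x) : V * V)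
  (GRing.isLinear.Build R V (V * V)%type *:%R _ pair_inr_is_linear).

Lemma smooth_left_inv v : smooth_on setT (left_inv G v).
Proof.
move=> n.
have [_ /(_ (0, v)) h] := gmul_smooth G n.+1.
have cP : continuous pair_inl.
  move=> x; have [h1 _] := is_diff_pair (is_diff_id x) (is_diff_cst (0 : V) x).
  exact: (differentiable_continuous h1).
have TT : forall x : V, setT x -> setT (pair_inl x + 0) by [].
have := Cn_on_affine openT cP TT h.
apply: (Cn_on_ext openT) => x _.
rewrite left_invE addr0.
exact: (is_diff_deriveE (0, v) (is_diff_gmul_pair x 0)).
Qed.

Lemma smooth_ltrans x : smooth_on setT (m x).
Proof.
move=> n.
have cP : continuous pair_inr.
  move=> y; have [h1 _] := is_diff_pair (is_diff_cst (0 : V) y) (is_diff_id y).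
  exact: (differentiable_continuous h1).
have TT : forall y : V, setT y -> setT (pair_inr y + (x, 0)) by [].
have := Cn_on_affine openT cP TT (gmul_smooth G n).
apply: (Cn_on_ext openT) => y _.
by rewrite -[pair_inr y + _]/(0 + x, y + 0) add0r addr0.
Qed.

Lemma differentiable_dgmul (E : normedModType R) (f g : E -> V) t u v :
  differentiable f t -> differentiable g t ->
  differentiable (fun s => dgmul (f s) (g s) u v) t.
Proof.
move=> df dg; have [_ /(_ (u, v)) [hs _]] := gmul_smooth G 2.
have hp := is_diff_pair (differentiableP df) (differentiableP dg).
have [h _] := is_diff_comp hp (differentiableP (hs (f t, g t) I)).
have -> : (fun s => dgmul (f s) (g s) u v) =
    'D_(u, v) (fun p : V * V => m p.1 p.2) \o (fun s => (f s, g s)).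
  apply/funext => s; apply: esym.
  exact: (is_diff_deriveE (u, v) (is_diff_gmul_pair (f s) (g s))).
exact: h.
Qed.

Lemma differentiable_left_inv v x : differentiable (left_inv G v) x.
Proof. by have [h _] := smooth_left_inv v 1; exact: h. Qed.

End LeftTranslations.

(** * The bracket as the derivative of conjugation *)

Section Conjugation.
Context {R : realType} {d : nat} (G : exp_lie_group R d).
Local Notation V := 'rV[R]_d.
Local Notation m := (gmul G).
Implicit Types (x y z v w : V).

(** The second-order part of the product at 0, as a bilinear form. In
    exponential coordinates it is alternating, hence equal to half of the
    bracket. *)
Definition left_inv_deriv x v : V := 'D_x (left_inv G v) 0.
Local Notation b := left_inv_deriv.

Lemma left_inv_derivDl x y v : b (x + y) v = b x v + b y v.
Proof.
rewrite /b !deriveE ?linearD//; exact: differentiable_left_inv.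
Qed.

Lemma left_inv_derivDr x v w : b x (v + w) = b x v + b x w.
Proof.
rewrite /b; have -> : left_inv G (v + w) = left_inv G v + left_inv G w.
  by apply/funext => y; rewrite left_invD.
by rewrite deriveD//; apply: diff_derivable; exact: differentiable_left_inv.
Qed.

(** The field of x is constant along the line through x. *)
Lemma left_inv_deriv_alt x : b x x = 0.
Proof.
have h := is_diff_comp (is_diff_line 0 x 0)
  (differentiableP (differentiable_left_inv G x (0 + 0 *: x))).
have h' : is_diff (0 : R) (left_inv G x \o (fun s => 0 + s *: x)) (cst 0).
  apply: is_diff_eqfun (is_diff_cst x 0) => // s /=.
  by rewrite add0r left_inv_radial.
have := is_diff_fun_unique h h' 1.
rewrite /= scale1r scale0r addr0 /b deriveE//.
exact: differentiable_left_inv.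
Qed.

Lemma left_inv_derivC x v : b x v = - b v x.
Proof.
apply/eqP; rewrite -addr_eq0; apply/eqP.
have := left_inv_deriv_alt (x + v).
by rewrite left_inv_derivDl !left_inv_derivDr !left_inv_deriv_alt addr0 add0r.
Qed.

Lemma lie_bracketE v w : lie_bracket G v w = 2 *: b v w.
Proof.
rewrite /lie_bracket /vf_bracket !left_inv0 -/(b v w) -/(b w v).
by rewrite (left_inv_derivC w v) opprK scaler_nat mulr2n.
Qed.

Lemma lie_bracketC v w : lie_bracket G v w = - lie_bracket G w v.
Proof. by rewrite !lie_bracketE left_inv_derivC scalerN. Qed.

Fact lie_bracket_is_linear v : linear (lie_bracket G v).
Proof.
move=> a u w; rewrite lie_bracketC !(lie_bracketC v) !lie_bracketE.
have -> : b (a *: u + w) v = a *: b u v + b w v.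
  have dv := differentiable_left_inv G v 0.
  exact: etrans (deriveE _ dv) (etrans (linearP _ _ _ _)
    (esym (congr2 (fun s t => a *: s + t) (deriveE u dv) (deriveE w dv)))).
by rewrite scalerDr opprD scalerN !scalerA mulrC.
Qed.

HB.instance Definition _ v :=
  GRing.isLinear.Build R V V *:%R (lie_bracket G v) (lie_bracket_is_linear v).

Lemma gmul_inv x y : - m x y = m (- y) (- x).
Proof.
have e : m (m x y) (m (- y) (- x)) = 0.
  by rewrite gmulA -(gmulA G x) gmulxN gmulx0 gmulxN.
by rewrite -[LHS](gmulx0 G) -e gmulA gmulNx gmul0x.
Qed.

(** Inversion x |-> -x exchanges left and right translations, so the
    right-invariant field of x at v is the left-invariant one at -v. This avoids
    any appeal to the symmetry of the mixed second derivative of the product. *)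
Lemma dgmul_right x v : dgmul G 0 v x 0 = left_inv G x (- v).
Proof.
have h := is_diff_gmul G (is_diff_id 0) (is_diff_cst v 0).
have hN : is_diff (0 : V) (-%R) (-%R) by exact: is_diffN (is_diff_id 0).
have h1 := is_diff_comp hN (is_diff_ltrans G (- v) (- 0)).
have h2 := is_diffN h1.
have h' : is_diff (0 : V) (- (m (- v) \o -%R)) (fun y => dgmul G 0 v y 0).
  have e y : m y v = - m (- v) (- y) by rewrite gmul_inv !opprK.
  by apply: is_diff_eqfun h => // y; exact: e.
have E : - dgmul G (- v) (- 0) 0 (- x) = dgmul G 0 v x 0.
  exact: is_diff_fun_unique h2 h' x.
by rewrite -E oppr0 left_invE dgmul0N opprK.
Qed.

Definition gconj x v : V := m (m x v) (- x).

Lemma gconj0 x : gconj x 0 = 0.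
Proof. by rewrite /gconj gmulx0 gmulxN. Qed.

Lemma gconjM x v w : gconj x (m v w) = m (gconj x v) (gconj x w).
Proof.
by rewrite /gconj !gmulA -(gmulA G _ (- x) x) gmulNx gmulx0.
Qed.

Lemma gconj_comp x y v : gconj (m x y) v = gconj x (gconj y v).
Proof. by rewrite /gconj gmul_inv !gmulA. Qed.

(** The multiples of v by integers are its powers in the group. *)
Lemma gconj_nat x v n : gconj x (n%:R *: v) = n%:R *: gconj x v.
Proof.
elim: n => [|n IH]; first by rewrite !scale0r gconj0.
by rewrite -natr1 -(gmul_exp G) gconjM IH scale1r -(gmul_exp G) scale1r.
Qed.

Lemma gconj_homog x v n : gconj x v = n.+1%:R *: gconj x (n.+1%:R^-1 *: v).
Proof.
by rewrite -gconj_nat scalerA divff ?scale1r// pnatr_eq0.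
Qed.

Lemma is_diff_gconj x v :
  is_diff v (gconj x) (fun u => dgmul G (m x v) (- x) (dgmul G x v 0 u) 0).
Proof.
exact: (is_diff_gmul G (is_diff_ltrans G x v) (is_diff_cst (- x) v)).
Qed.

(** Conjugation is its own differential at 0, because it is homogeneous: in
    exponential coordinates automorphisms are linear. *)
Lemma is_diff_gconj0 x : is_diff 0 (gconj x) (gconj x).
Proof.
have [h _] := is_diff_gconj x 0; have := differentiableP h.
apply: is_diff_eqfun => // v; rewrite -deriveE//.
by rewrite -homogeneous_eq_derive ?gconj0//; exact: gconj_homog.
Qed.

(** The derivative at t = 0 of (t x) v (-(t x)) is the difference k v of the
    right- and left-invariant fields of x at v. It inherits homogeneity in v
    from conjugation, so it equals its own derivative at 0, which is a bracket.
    *)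
Lemma is_diff_gconj_flow x v :
  is_diff (0 : R) (fun t => gconj (t *: x) v)
    (fun t => - t *: lie_bracket G v x).
Proof.
pose k w := left_inv G x (- w) - left_inv G x w.
have kE w : is_diff (0 : R) (fun t => gconj (t *: x) w) (fun t => t *: k w).
  have h1 : is_diff (0 : R) (fun s : R => s *: x) (fun s => s *: x).
    exact: is_diff_scalel.
  have h2 := is_diff_gmul G h1 (is_diff_cst w 0).
  have h3 : is_diff (0 : R) (fun s : R => - (s *: x)) (fun s => - (s *: x)).
    exact: is_diffN h1.
  have := is_diff_gmul G h2 h3; apply: is_diff_eqfun => // t /=.
  rewrite scale0r oppr0 gmul0x dgmulD dgmul_x0 /k scalerBr.
  congr (_ + _); first by rewrite -dgmul_right -dgmulZ0.
  by rewrite -[X in dgmul _ _ _ _ X]/(- (t *: x)) dgmul0N dgmul0Z -left_invE.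
have dL := differentiableP (differentiable_left_inv G x (- 0)).
have dk : is_diff 0 k
    (fun u => 'd (left_inv G x) (- 0) (- u) - 'd (left_inv G x) 0 u).
  have hN : is_diff (0 : V) (-%R) (-%R) by exact: is_diffN (is_diff_id 0).
  have d0 := differentiableP (differentiable_left_inv G x 0).
  exact: (is_diffB (is_diff_comp hN dL) d0).
have kD : k v = - lie_bracket G v x.
  rewrite homogeneous_eq_derive; first last.
  - move=> n; have h1 := kE v.
    have h2 := is_diffZ n.+1%:R (kE (n.+1%:R^-1 *: v)).
    have h3 : is_diff (0 : R)
        (n.+1%:R \*: (fun t => gconj (t *: x) (n.+1%:R^-1 *: v)))
        (fun t => t *: k v).
      by apply: is_diff_eqfun h1 => // t; exact: gconj_homog.
    have E : 1 *: k v = n.+1%:R *: (1 *: k (n.+1%:R^-1 *: v)).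
      exact: is_diff_fun_unique h3 h2 1.
    apply: etrans (esym (scale1r _)) (etrans E _).
    by congr (_ *: _); exact: scale1r.
  - by rewrite /k oppr0 subrr.
  - by case: dk.
  rewrite (is_diff_deriveE v dk) oppr0 linearN -!deriveE; last first.
    exact: differentiable_left_inv.
  by rewrite -/(left_inv_deriv v x) lie_bracketE scaler_nat mulr2n opprD.
apply: is_diff_eqfun (kE v) => // t.
by rewrite kD scalerN scaleNr.
Qed.

End Conjugation.

(** * The Maurer-Cartan form and characters *)

Section MaurerCartan.
Context {R : realType} {d : nat} (G : exp_lie_group R d).
Local Notation V := 'rV[R]_d.
Local Notation m := (gmul G).
Implicit Types (x y z v w : V).

(** The left translation of a tangent vector at x back to the identity. *)
Definition maurer_cartan x v : V := dgmul G (- x) x 0 v.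

Fact maurer_cartan_is_linear x : linear (maurer_cartan x).
Proof.
move=> a u v; rewrite /maurer_cartan -dgmul0Z /dgmul -linearD; congr ('d _ _ _).
by rewrite -[RHS]/(0 + 0, a *: u + v) addr0.
Qed.

HB.instance Definition _ x :=
  GRing.isLinear.Build R V V *:%R (maurer_cartan x) (maurer_cartan_is_linear x).

Lemma maurer_cartan_left_inv x v : maurer_cartan x (left_inv G v x) = v.
Proof.
have h1 := is_diff_ltrans G x 0.
have h2 := is_diff_ltrans G (- x) (m x 0).
have h : is_diff (0 : V) (m (- x) \o m x) id.
  apply: is_diff_eqfun (is_diff_id 0) => // y /=.
  by rewrite gmulA gmulNx gmul0x.
have := is_diff_fun_unique (is_diff_comp h1 h2) h v.
by rewrite /= gmulx0 left_invE.
Qed.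

Lemma left_inv_maurer_cartan x v : left_inv G (maurer_cartan x v) x = v.
Proof.
have h1 := is_diff_ltrans G (- x) x.
have h2 := is_diff_ltrans G x (m (- x) x).
have h : is_diff (x : V) (m x \o m (- x)) id.
  apply: is_diff_eqfun (is_diff_id x) => // y /=.
  by rewrite gmulA gmulxN gmul0x.
have := is_diff_fun_unique (is_diff_comp h1 h2) h v.
by rewrite /= gmulNx left_invE.
Qed.

(* The i-th coordinate is a character of the Lie algebra; the lemmas below say
   that it is invariant under conjugation and under left translation. *)
Variable i : 'I_d.
Hypothesis bracket_i : forall v w, lie_bracket G v w 0 i = 0.

(** Along t |-> (t x) v (-(t x)) the i-th coordinate has derivative zero:
    conjugation by t x is a one-parameter group, and its derivative at any time
    is the bracket of x with the vector reached. *)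
Lemma gconj_character x v : gconj G x v 0 i = v 0 i.
Proof.
pose g (t : R) := gconj G (t *: x) v 0 i.
suff : g 1 = g 0.
  by rewrite /g scale1r scale0r /gconj => ->; rewrite oppr0 gmulx0 gmul0x.
apply: is_derive_0_is_cst => t.
pose h s := gconj G (s *: x) (gconj G (t *: x) v) 0 i.
have gE s : h (s - t) = g s.
  by rewrite /h /g -gconj_comp gmul_exp subrK.
have dh : is_diff (0 : R) h (fun=> 0).
  have flow := is_diff_gconj_flow G x (gconj G (t *: x) v).
  apply: is_diff_eqfun (is_diff_coord i flow) => // s.
  by rewrite mxE bracket_i mulr0.
have dt : is_diff t (fun s : R => s - t) id.
  apply: is_diff_eqfun (is_diffB (is_diff_id t) (is_diff_cst t t)) => // s.
  exact: subr0.
have dh' : is_diff (t - t) h (fun=> 0) by rewrite subrr.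
have dg : is_diff t g (fun=> 0).
  exact: (is_diff_eqfun gE (fun=> erefl) (is_diff_comp dt dh')).
split; last by rewrite (is_diff_deriveE (1 : R) dg).
by case: dg => dg _; exact: diff_derivable.
Qed.

(* At t = 1 the derivative of radial_quot x t at x is the Maurer-Cartan form.
   The interest of a general t is the cocycle relation below. *)
Let radial_quot x t y := m (- (t *: x)) (t *: y).
Let d_radial_quot x t v := dgmul G (- (t *: x)) (t *: x) 0 (t *: v).

Let is_diff_radial_quot x t : is_diff x (radial_quot x t) (d_radial_quot x t).
Proof.
have h := is_diff_ltrans G (- (t *: x)) (t *: x).
exact: (is_diff_comp (is_diff_scaler t x) h).
Qed.

(* Write s, a, b and c for r x, t x, t y and r y.  The left-hand side is
   (-s) (-a) b c; inserting s (-s) before c makes the two factors appear. *)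
Let radial_quot_cocycle x t r y :
  radial_quot x (t + r) y =
  m (gconj G (- (r *: x)) (radial_quot x t y)) (radial_quot x r y).
Proof.
rewrite /radial_quot /gconj opprK !gmulA -(gmulA G _ (r *: x)) gmulxN gmulx0.
rewrite -!gmulA gmul_exp gmulA.
by congr m; rewrite -!scaleNr gmul_exp addrC opprD.
Qed.

Let d_radial_quot_add x t r v : d_radial_quot x (t + r) v =
  gconj G (- (r *: x)) (d_radial_quot x t v) + d_radial_quot x r v.
Proof.
have quot0 s : radial_quot x s x = 0 by rewrite /radial_quot gmulNx.
have h0 := is_diff_gconj0 G (- (r *: x)); rewrite -(quot0 t) in h0.
have h := is_diff_gmul G (is_diff_comp (is_diff_radial_quot x t) h0)
  (is_diff_radial_quot x r).
have h' := is_diff_eqfun (fun y => esym (radial_quot_cocycle x t r y))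
  (fun=> erefl) h.
rewrite (is_diff_fun_unique (is_diff_radial_quot x (t + r)) h') /=.
rewrite !quot0 gconj0.
by rewrite dgmulD dgmul_x0 dgmul_0x.
Qed.

(** The cocycle relation and the invariance under conjugation make phi t = t psi
    t additive in t, hence homogeneous; so phi 1 is the derivative of phi at 0,
    that is psi 0. *)
Lemma maurer_cartan_character x v : maurer_cartan x v 0 i = v 0 i.
Proof.
pose psi (t : R) := maurer_cartan (t *: x) v 0 i.
pose phi (t : R) := t *: psi t.
have phiE t : phi t = d_radial_quot x t v 0 i.
  by rewrite /d_radial_quot dgmul0Z mxE.
have phiD t r : phi (t + r) = phi t + phi r.
  by rewrite !phiE d_radial_quot_add mxE gconj_character.
have dpsi : differentiable psi 0.
  have [h1 _] : is_diff (0 : R) (fun s : R => s *: x) (fun s => s *: x).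
    exact: is_diff_scalel.
  have [hN _] := is_diffN (differentiableP h1).
  have hp := differentiableP (differentiable_dgmul G 0 v hN h1).
  by case: (is_diff_coord i hp).
have dphi := is_diff_scale (is_diff_id (0 : R)) (differentiableP dpsi).
have phin n t : phi (n%:R * t) = n%:R * phi t.
  elim: n => [|n IH]; first by rewrite !mul0r /phi scale0r.
  by rewrite -natr1 !mulrDl !mul1r phiD IH.
have phi1 : phi 1 = 'D_1 phi 0.
  apply: homogeneous_eq_derive; first by case: dphi.
    by rewrite /phi scale0r.
  move=> n; rewrite -[RHS]/(n.+1%:R * phi (n.+1%:R^-1 * 1)) -phin mulrA.
  by rewrite divff ?mulr1 // pnatr_eq0.
have -> : maurer_cartan x v 0 i = phi 1.
  by rewrite phiE /d_radial_quot /maurer_cartan !scale1r.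
apply: etrans phi1 (etrans (is_diff_deriveE (1 : R) dphi) _).
rewrite scale0r add0r /psi /maurer_cartan !scale0r oppr0 dgmul_0x.
exact: scale1r.
Qed.

End MaurerCartan.

(** * Brackets of vector fields *)

Section Fields.
Context {R : realType}.
Implicit Types E F : normedModType R.

Lemma is_diff_sum E F (I : Type) (r : seq I) (f df : I -> E -> F) x :
  (forall i, is_diff x (f i) (df i)) ->
  is_diff x (fun y => \sum_(i <- r) f i y) (fun v => \sum_(i <- r) df i v).
Proof.
move=> fx; elim: r => [|i r IH].
  by apply: is_diff_eqfun (is_diff_cst 0 x) => y; rewrite big_nil.
by apply: is_diff_eqfun (is_diffD (fx i) IH) => y; rewrite big_cons.
Qed.

(** The product rule for the evaluation of a moving linear map at a moving
    vector. It is used with T the differential of a map, the left-invariant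
    fields and the Maurer-Cartan form. *)
Lemma is_diff_linear_family E F d (T : E -> {linear 'rV[R]_d -> F})
    (Y : E -> 'rV[R]_d) x :
  (forall w, differentiable (fun z => T z w) x) -> differentiable Y x ->
  is_diff x (fun z => T z (Y z))
    (fun u => T x ('d Y x u) + 'd (fun z => T z (Y x)) x u).
Proof.
move=> dT dY.
have h w : is_diff x (fun z => T z w)
    (fun u => \sum_(i < d) w 0 i *: 'd (fun z => T z (basis_vec R i)) x u).
  have := is_diff_sum (index_enum _) (fun i =>
    is_diffZ (w 0 i) (differentiableP (dT (basis_vec R i)))).
  by apply: is_diff_eqfun => // z; rewrite linear_rowE.
have hY := is_diff_sum (index_enum _) (fun i => is_diff_scale
  (is_diff_coord i (differentiableP dY))
  (differentiableP (dT (basis_vec R i)))).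
apply: is_diff_eqfun hY => z; first by rewrite linear_rowE.
rewrite big_split /= addrC [T x _]linear_rowE; congr (_ + _).
exact: (is_diff_fun_unique (h (Y x)) (differentiableP (dT (Y x)))).
Qed.

Context {d : nat}.
Local Notation V := 'rV[R]_d.

Lemma derive_diff_field (f : V -> V) (U : set V) (Y : vfield R d) x :
  open U -> U x -> Cn_on 2 U f -> differentiable Y x ->
  is_diff x (fun z => 'd f z (Y z))
    (fun u => 'd f x ('d Y x u) + 'D_u ('D_(Y x) f) x).
Proof.
move=> oU Ux [df Df] dY.
have near_D w : \near x, 'D_w f x = 'd f x w.
  near=> z; rewrite deriveE//; apply: df.
  by near: z; exact: open_nbhs_nbhs.
have dD w : is_diff x (fun z => 'd f z w) ('d ('D_w f) x).
  have [dw _] := Df w.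
  exact: is_diff_near (near_D w) (differentiableP (dw x Ux)).
have dfD w : differentiable (fun z => 'd f z w) x by case: (dD w).
have h := @is_diff_linear_family _ _ _ (fun z => 'd f z) Y x dfD dY.
apply: is_diff_eqfun h => // v; congr (_ + _).
have [_ ->] := dD (Y x); have [dw _] := Df (Y x).
by rewrite deriveE//; exact: dw.
Unshelve. all: by end_near. Qed.

(** Differentiating the relation d f (Y) = Y' o f in the direction X gives d f
    (D_X Y) + D^2 f (X, Y) = D_{X'} Y'; the second derivative cancels in the
    difference of this identity and of the one with X and Y exchanged. *)
Lemma vf_bracket_related (f : V -> V) (U : set V) (X Y X' Y' : vfield R d) x :
  open U -> U x -> Cn_on 2 U f ->
  differentiable X x -> differentiable Y x ->
  differentiable X' (f x) -> differentiable Y' (f x) ->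
  (forall z, U z -> 'd f z (X z) = X' (f z)) ->
  (forall z, U z -> 'd f z (Y z) = Y' (f z)) ->
  'd f x (vf_bracket X Y x) = vf_bracket X' Y' (f x).
Proof.
move=> oU Ux fU dX dY dX' dY' XX' YY'.
have [df _] := fU.
have key Z Z' u : differentiable Z x -> differentiable Z' (f x) ->
    (forall z, U z -> 'd f z (Z z) = Z' (f z)) ->
    'd f x ('d Z x u) + 'D_u ('D_(Z x) f) x = 'd Z' (f x) ('d f x u).
  move=> dZ dZ' ZZ'.
  have h1 := derive_diff_field oU Ux fU dZ.
  have h2 := is_diff_comp (differentiableP (df x Ux)) (differentiableP dZ').
  have nZ : \near x, 'd f x (Z x) = (Z' \o f) x.
    by near=> z; apply: ZZ'; near: z; exact: open_nbhs_nbhs.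
  exact: (is_diff_fun_unique (is_diff_near nZ h1) h2 u).
have E1 : vf_bracket X Y x = 'd Y x (X x) - 'd X x (Y x).
  exact: (congr2 (fun a b => a - b) (deriveE (X x) dY) (deriveE (Y x) dX)).
have E2 : vf_bracket X' Y' (f x) =
    'd Y' (f x) (X' (f x)) - 'd X' (f x) (Y' (f x)).
  exact: (congr2 (fun a b => a - b)
    (deriveE (X' (f x)) dY') (deriveE (Y' (f x)) dX')).
have kY := etrans (key _ _ (X x) dY dY' YY') (congr1 ('d Y' (f x)) (XX' x Ux)).
have kX := etrans (key _ _ (Y x) dX dX' XX') (congr1 ('d X' (f x)) (YY' x Ux)).
have S := schwarz (X x) (Y x) oU Ux fU.
have cancel (a b p q : V) : p = q -> a - b = (a + p) - (b + q).
  by move=> ->; rewrite opprD addrACA subrr addr0.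
apply: etrans (congr1 ('d f x) E1)
  (etrans (linearB ('d f x) _ _) (etrans _ (esym E2))).
exact: etrans (cancel _ _ _ _ S) (congr2 (fun a b => a - b) kY kX).
Unshelve. all: by end_near. Qed.

Variable G : exp_lie_group R d.
Local Notation m := (gmul G).

(** A left-invariant field is related to itself by left translations, and the
    statement at the identity is the definition of the bracket. *)
Lemma vf_bracket_left_inv v w x :
  vf_bracket (left_inv G v) (left_inv G w) x = left_inv G (lie_bracket G v w) x.
Proof.
have dm z : 'd (m x) z =1 dgmul G x z 0 by case: (is_diff_ltrans G x z) => _ ->.
have rel u z : setT z -> 'd (m x) z (left_inv G u z) = left_inv G u (m x z).
  move=> _; rewrite dm !left_invE.
  have h1 := is_diff_ltrans G z 0; have h2 := is_diff_ltrans G x (m z 0).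
  have h3 := is_diff_ltrans G (m x z) 0.
  have h : is_diff (0 : V) (m (m x z)) (dgmul G x (m z 0) 0 \o dgmul G z 0 0).
    by apply: is_diff_eqfun (is_diff_comp h1 h2) => // y /=; rewrite gmulA.
  by rewrite (is_diff_fun_unique h3 h u) /= gmulx0.
have := vf_bracket_related (X' := left_inv G v) (Y' := left_inv G w)
  openT (I : setT (0 : V)) (smooth_ltrans G x 2)
  (differentiable_left_inv G v 0) (differentiable_left_inv G w 0)
  (differentiable_left_inv G v (m x 0)) (differentiable_left_inv G w (m x 0))
  (rel v) (rel w).
by rewrite gmulx0 dm -/(lie_bracket G v w) left_invE.
Qed.

Fact left_inv_is_linear x : linear (fun v : V => left_inv G v x).
Proof. by move=> a u v; rewrite left_invD left_invZ. Qed.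

(** The same value as that of [left_inv], seen as a linear map of the vector. *)
Definition left_inv_at x : {linear V -> V} :=
  HB.pack (fun v : V => left_inv G v x)
  (GRing.isLinear.Build R V V *:%R _ (left_inv_is_linear x)).

Lemma differentiable_maurer_cartan (X : vfield R d) x : differentiable X x ->
  differentiable (fun z => maurer_cartan G z (X z)) x.
Proof.
move=> dX.
have [hN _] : is_diff (x : V) (-%R) (-%R) by exact: is_diffN (is_diff_id x).
have [hI _] := is_diff_id x.
have dT w := differentiable_dgmul G 0 w hN hI.
by have [] :=
  @is_diff_linear_family _ _ _ (fun z => maurer_cartan G z) X x dT dX.
Qed.

(** The structure equation. Write X as the left-invariant field of a moving
    vector a and Y as that of b. The product rule splits D_X Y into the part
    where b moves and the part where b is frozen; the frozen parts assemble into
    the bracket of two left-invariant fields. *)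
Lemma maurer_cartan_bracket (X Y : vfield R d) x :
  differentiable X x -> differentiable Y x ->
  maurer_cartan G x (vf_bracket X Y x) =
    'D_(X x) (fun z => maurer_cartan G z (Y z)) x
    - 'D_(Y x) (fun z => maurer_cartan G z (X z)) x
    + lie_bracket G (maurer_cartan G x (X x)) (maurer_cartan G x (Y x)).
Proof.
move=> dX dY.
have key Z u : differentiable Z x -> 'D_u Z x =
   left_inv G ('D_u (fun z => maurer_cartan G z (Z z)) x) x
    + 'D_u (left_inv G (maurer_cartan G x (Z x))) x.
  move=> dZ; have da := differentiable_maurer_cartan dZ.
  have h := @is_diff_linear_family _ _ _ left_inv_at _ x
    (fun w => differentiable_left_inv G w x) da.
  have h' : is_diff x
      (fun z => left_inv G (maurer_cartan G z (Z z)) z) ('d Z x).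
    apply: is_diff_eqfun (differentiableP dZ) => // z.
    by rewrite left_inv_maurer_cartan.
  rewrite (deriveE _ dZ) (deriveE _ da).
  rewrite (deriveE _ (differentiable_left_inv G _ x)).
  exact: (is_diff_fun_unique h' h u).
rewrite {1}/vf_bracket (key X _ dX) (key Y _ dY).
set a := maurer_cartan G x (X x); set b := maurer_cartan G x (Y x).
rewrite opprD addrACA.
rewrite -[X in _ + X]/('D_(X x) (left_inv G b) x - 'D_(Y x) (left_inv G a) x).
have -> : 'D_(X x) (left_inv G b) x - 'D_(Y x) (left_inv G a) x =
   left_inv G (lie_bracket G a b) x.
  by rewrite -vf_bracket_left_inv /vf_bracket !left_inv_maurer_cartan.
by rewrite linearD linearB /= !maurer_cartan_left_inv.
Qed.

End Fields.

(** * Layers and the standard filtration *)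

(** A subspace of maximal dimension contained in P must exhaust P, otherwise a
    further vector of P could be added to it. This lets a subspace be cut out by
    infinitely many analytic conditions. *)
Lemma exists_vspace (K : fieldType) (vT : vectType K) (P : vT -> Prop) :
  P 0 -> (forall a u v, P u -> P v -> P (a *: u + v)) ->
  exists W : {vspace vT}, forall v, v \in W <-> P v.
Proof.
move=> P0 PD.
pose Q n :=
  `[< exists2 W : {vspace vT}, \dim W = n & forall v, v \in W -> P v >].
have Q0 : exists n, Q n.
  exists 0%N; apply/asboolP; exists 0%VS; first by rewrite dimv0.
  by move=> v; rewrite memv0 => /eqP ->.
have Qb n : Q n -> (n <= \dim {:vT})%N.
  by move=> /asboolP[W <- _]; exact/dimvS/subvf.
case: (ex_maxnP Q0 Qb) => n /asboolP[W dW WP] nmax.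
exists W => v; split; first exact: WP.
move=> Pv; apply: contrapT => /negP vW.
suff /nmax : Q (\dim (W + <[v]>)%VS).
  apply/negP; rewrite -ltnNge -dW ltnNge; apply/negP => le.
  have /eqP WE : (W == W + <[v]>)%VS by rewrite eqEdim addvSl.
  by move: vW; rewrite WE (subvP (addvSr W <[v]>))// memv_line.
apply/asboolP; exists (W + <[v]>)%VS => //.
move=> _ /memv_addP[u uW [_ /vlineP[a ->] ->]].
by rewrite addrC; apply: PD => //; exact: WP.
Qed.

Section Layers.
Context {R : realType} {d : nat}.
Local Notation V := 'rV[R]_d.

Lemma mem_basis_span (P : pred 'I_d) (v : V) :
  v \in (\sum_(j < d | P j) <[basis_vec R j]>)%VS <->
  forall j, ~~ P j -> v 0 j = 0.
Proof.
split=> [/memv_sumP[u uP ->] j Pj|vP].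
  rewrite summxE big1// => i Pi; have /vlineP[a ->] := uP i Pi.
  by rewrite !mxE eqxx /=; case: eqP Pj => [->|]; rewrite ?Pi// mulr0.
rewrite (row_sum_delta v) (bigID P) /= [X in _ + X]big1 ?addr0.
  apply: memv_sumr => j Pj; exact/memvZ/memv_line.
by move=> j /vP ->; rewrite scale0r.
Qed.

Variable G : stratified_group R d.
Local Notation g n := (graded_layer R (wt G) n).
Local Notation mc := (maurer_cartan G).

(** The Maurer-Cartan form inverts the differential of left translation, so that
    membership in a left-translated subspace becomes a condition on coordinates.
    *)
Lemma mem_tangent_ltrans x (U : {vspace V}) v :
  (v \in (tangent_map (gmul G x) 0 @: U)%VS) = (mc x v \in U).
Proof.
apply/idP/idP => [/memv_imgP[u uU ->]|mU].
  by rewrite -/(left_inv G u x) maurer_cartan_left_inv.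
by rewrite -(left_inv_maurer_cartan G x v); apply: memv_img.
Qed.

Lemma std_filtrationE n x : std_filtration G n x =
  (tangent_map (gmul G x) 0 @:
     (\sum_(j < d | (wt G j <= n)%N) <[basis_vec R j]>))%VS.
Proof.
rewrite /std_filtration; elim: n => [|n IH].
  rewrite big_geq// big_pred0 ?limg0// => j.
  by apply/negbTE; rewrite -ltnNge wt_gt0.
rewrite big_nat_recr//= IH /layer_at -limgD; congr (_ @: _)%VS.
rewrite /graded_layer [RHS](bigID (fun j => wt G j <= n)%N) /=.
by congr (_ + _)%VS; apply: eq_bigl => j; lia.
Qed.

Lemma mem_layer n (v : V) : v \in g n <-> forall j, wt G j != n -> v 0 j = 0.
Proof. exact: mem_basis_span. Qed.

Lemma mem_layer_at n x v :
  v \in layer_at G n x <-> forall j, wt G j != n -> mc x v 0 j = 0.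
Proof. by rewrite /layer_at mem_tangent_ltrans; exact: mem_layer. Qed.

Lemma mem_std_filtration n x v : v \in std_filtration G n x <->
  forall j, (n < wt G j)%N -> mc x v 0 j = 0.
Proof.
rewrite std_filtrationE mem_tangent_ltrans.
rewrite (mem_basis_span (fun j => wt G j <= n)%N).
by split=> h j; [rewrite ltnNge => /h|rewrite -ltnNge => /h].
Qed.

Lemma std_filtration1 x : std_filtration G 1 x = layer_at G 1 x.
Proof. by rewrite /std_filtration big_nat1. Qed.

Lemma lie_bracket_sum (I J : Type) (r : seq I) (s : seq J)
    (P : pred I) (Q : pred J) (f : I -> V) (h : J -> V) :
  lie_bracket G (\sum_(i <- r | P i) f i) (\sum_(j <- s | Q j) h j) =
  \sum_(i <- r | P i) \sum_(j <- s | Q j) lie_bracket G (f i) (h j).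
Proof.
rewrite lie_bracketC linear_sum /= -sumrN; apply: eq_bigr => i _.
by rewrite -lie_bracketC linear_sum.
Qed.

Lemma lie_bracket_coord (v w : V) l : lie_bracket G v w 0 l =
  \sum_(i < d) \sum_(j < d) v 0 i * (w 0 j *
    lie_bracket G (basis_vec R i) (basis_vec R j) 0 l).
Proof.
rewrite {1}(row_sum_delta v) {1}(row_sum_delta w) lie_bracket_sum summxE.
apply: eq_bigr => i _; rewrite summxE; apply: eq_bigr => j _.
rewrite lie_bracketC linearZ /= -scalerN -lie_bracketC linearZ /=.
by rewrite [LHS]mxE; congr (_ * _); rewrite [LHS]mxE.
Qed.

Lemma basis_vec_layer k : basis_vec R k \in g (wt G k).
Proof.
apply/mem_layer => j jk; rewrite mxE /=.
by case: (j =P k) jk => [->|//]; rewrite eqxx.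
Qed.

Lemma lie_bracket_filtered a b (v w : V) l :
  (forall j, (a < wt G j)%N -> v 0 j = 0) ->
  (forall j, (b < wt G j)%N -> w 0 j = 0) ->
  (a + b < wt G l)%N -> lie_bracket G v w 0 l = 0.
Proof.
move=> va wb abl; rewrite lie_bracket_coord.
rewrite big1// => i _; rewrite big1// => j _.
have [ia|ia] := ltnP a (wt G i); first by rewrite va// mul0r.
have [jb|jb] := ltnP b (wt G j); first by rewrite wb// mul0r mulr0.
have /mem_layer h := layer_bracket (basis_vec_layer i) (basis_vec_layer j).
rewrite h ?mulr0//.
by rewrite gtn_eqF// (leq_ltn_trans _ abl)// leq_add.
Qed.

(** A bracket of basis vectors has weight at least 2, since weights are
    positive. *)
Lemma lie_bracket_horizontal (v w : V) l :
  horizontal G l -> lie_bracket G v w 0 l = 0.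
Proof.
move=> /eqP hl; rewrite lie_bracket_coord big1// => i _; rewrite big1// => j _.
have /mem_layer h := layer_bracket (basis_vec_layer i) (basis_vec_layer j).
rewrite h ?mulr0//.
by rewrite hl; have := wt_gt0 G i; have := wt_gt0 G j; lia.
Qed.

(** In the structure equation the l-th coordinates of the Maurer-Cartan forms of
    X and Y vanish identically near y when the weight of l exceeds a and b, so
    their derivatives vanish; the bracket term vanishes by the grading. *)
Lemma std_filtration_bracket a b (W : set V) (X Y : vfield R d) y :
  open W -> W y -> differentiable X y -> differentiable Y y ->
  (forall z, W z -> X z \in std_filtration G a z) ->
  (forall z, W z -> Y z \in std_filtration G b z) ->
  vf_bracket X Y y \in std_filtration G (a + b) y.
Proof.
move=> oW Wy dX dY Xa Yb; apply/mem_std_filtration => l abl.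
have coordE (p q r : V) : (p - q + r) 0 l = p 0 l - q 0 l + r 0 l.
  by rewrite !mxE.
have dmc n (Z : vfield R d) u : differentiable Z y -> (n < wt G l)%N ->
    (forall z, W z -> Z z \in std_filtration G n z) ->
    ('D_u (fun z => mc z (Z z)) y) 0 l = 0.
  move=> dZ nl Zn.
  have E := derive_coord u l (differentiable_maurer_cartan G dZ).
  apply: etrans (esym E) _.
  apply: etrans _ (derive_cst (0 : R) y u); apply: near_eq_derive; near=> z.
  have /mem_std_filtration -> // : Z z \in std_filtration G n z.
  by apply: Zn; near: z; exact: open_nbhs_nbhs.
have al : (a < wt G l)%N by apply: leq_ltn_trans abl; exact: leq_addr.
have bl : (b < wt G l)%N by apply: leq_ltn_trans abl; exact: leq_addl.
have brl : lie_bracket G (mc y (X y)) (mc y (Y y)) 0 l = 0.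
  have /mem_std_filtration hX := Xa y Wy.
  have /mem_std_filtration hY := Yb y Wy.
  exact: lie_bracket_filtered hX hY abl.
apply: etrans (congr1 (fun u : V => u 0 l) (maurer_cartan_bracket G dX dY)) _.
apply: etrans (coordE _ _ _) _.
apply: etrans (congr2 (fun s t => s + t) (congr2 (fun s t => s - t)
  (dmc b Y (X y) dY bl Yb) (dmc a X (Y y) dX al Xa)) brl) _.
by rewrite subrr addr0.
Unshelve. all: by end_near. Qed.

End Layers.

(** * Horizontal vectors in exponential coordinates *)

Section Horizontal.
Context {R : realType} {d : nat} (G : stratified_group R d).
Local Notation V := 'rV[R]_d.
Local Notation mc := (maurer_cartan G).

Lemma maurer_cartan_horizontal x v i : horizontal G i -> mc x v 0 i = v 0 i.
Proof.
move=> hi; apply: maurer_cartan_character => u w.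
exact: lie_bracket_horizontal.
Qed.

Lemma Zfield_horizontal i j x :
  horizontal G i -> Zfield G j x 0 i = (i == j)%:R.
Proof.
move=> hi; rewrite -(maurer_cartan_horizontal x _ hi).
by rewrite [maurer_cartan _ _ _]maurer_cartan_left_inv mxE.
Qed.

Lemma Zfield_expand x v : v = \sum_(j < d) mc x v 0 j *: Zfield G j x.
Proof.
rewrite -{1}(left_inv_maurer_cartan G x v).
exact: (linear_rowE (left_inv_at G x) (mc x v)).
Qed.

Lemma Zfield_layer j x : Zfield G j x \in layer_at G (wt G j) x.
Proof. exact/memv_img/basis_vec_layer. Qed.

Lemma layer1_sum x (c : 'I_d -> R) :
  \sum_(j < d | horizontal G j) c j *: Zfield G j x \in layer_at G 1 x.
Proof.
apply: memv_suml => j /eqP hj; apply: memvZ.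
by have := Zfield_layer j x; rewrite hj.
Qed.

(** The coefficients of v in the frame of the Z_j are those of its Maurer-Cartan
    form, and the horizontal ones are the coordinates of v itself. *)
Lemma layer1_expand x v : v \in layer_at G 1 x ->
  v = \sum_(j < d | horizontal G j) v 0 j *: Zfield G j x.
Proof.
move=> /mem_layer_at h.
rewrite {1}(Zfield_expand x v) (bigID (horizontal G)) /=.
rewrite [X in _ + X]big1 ?addr0; last by move=> j /h ->; rewrite scale0r.
by apply: eq_bigr => j hj; rewrite maurer_cartan_horizontal.
Qed.

(** The orthogonality to the i-th vector says that the i-th coordinate of v is
    the one of the sum of the v_j Z_j(x); for horizontal i this equality holds
    for every v. *)
Lemma Fspace_layer1 x v : Fspace G x v <-> v \in layer_at G 1 x.
Proof.
have orthE i : \sum_(k < d) v 0 k * (basis_vec R i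
      - \sum_(j < d | horizontal G j) Zcoef G j i x *: basis_vec R j) 0 k
    = v 0 i - \sum_(j < d | horizontal G j) v 0 j * Zcoef G j i x.
  have e k : (\sum_(j < d | horizontal G j) Zcoef G j i x *: basis_vec R j) 0 k
      = if horizontal G k then Zcoef G k i x else 0.
    rewrite summxE big_mkcond (bigD1 k) //= big1 ?addr0 => [|j jk].
      by case: ifP => // _; rewrite !mxE !eqxx mulr1.
    by case: ifP => // _; rewrite !mxE eqxx /= eq_sym (negbTE jk) mulr0.
  under eq_bigr => k _ do rewrite mxE [X in _ + X]mxE e mulrBr.
  rewrite sumrB; congr (_ - _); last first.
    rewrite [RHS]big_mkcond; apply: eq_bigr => k _.
    by case: ifP; rewrite ?mulr0.
  rewrite (bigD1 i)//= big1 ?addr0 => [|k ki]; first by rewrite mxE !eqxx mulr1.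
  by rewrite mxE (negbTE ki) mulr0.
split=> [Fv|/layer1_expand vE i /= _].
  suff -> : v = \sum_(j < d | horizontal G j) v 0 j *: Zfield G j x.
    exact: layer1_sum.
  apply/rowP => i; rewrite summxE.
  have [hi|hi] := boolP (horizontal G i).
    rewrite (bigD1 i) //= big1 ?addr0 => [|j /andP[_ ji]].
      by rewrite mxE Zfield_horizontal// eqxx mulr1.
    by rewrite mxE Zfield_horizontal// eq_sym (negbTE ji) mulr0.
  have := Fv i hi; rewrite /orth /= orthE => /eqP; rewrite subr_eq0 => /eqP ->.
  by apply: eq_bigr => j _; rewrite mxE.
rewrite /orth /= orthE {1}vE summxE; apply/eqP; rewrite subr_eq0; apply/eqP.
by apply: eq_bigr => j _; rewrite mxE.
Qed.

End Horizontal.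

(** * Pushing vector fields forward *)

Section Pushforward.
Context {R : realType} {d : nat}.
Local Notation V := 'rV[R]_d.

Lemma smooth_coord i (U : set V) : smooth_on U (fun v : V => v 0 i).
Proof.
move=> n; elim: n => [|n IH]; first by move=> v _; exact: coord_continuous.
split=> [v _|u]; first exact: differentiable_coord.
have -> : (fun v : V => 'D_u (fun v : V => v 0 i) v) = (fun=> u 0 i).
  apply/funext => v.
  exact: (is_diff_deriveE u (is_diff_coord i (is_diff_id v))).
exact: Cn_on_cst.
Qed.

Variables (U U' : set V) (Phi Psi : V -> V).
Hypotheses (oU : open U) (oU' : open U').
Hypothesis dPhi : diffeomorphism U U' Phi Psi.

(** The field whose derivation is the operator [vf_pushforward]. *)
Definition pushfield (X : vfield R d) : vfield R d :=
  fun y => 'd Phi (Psi y) (X (Psi y)).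

Let Phi_diff x : U x -> differentiable Phi x.
Proof. by have [h _ _ _ _] := dPhi; have [h' _] := h 1%N; exact: h'. Qed.

Let PsiU y : U' y -> U (Psi y).
Proof. by have [_ _ _ h _] := dPhi; exact: h. Qed.

Let PhiK y : U' y -> Phi (Psi y) = y.
Proof. by have [_ _ _ _ [_ h]] := dPhi; exact: h. Qed.

Lemma pushfield_related (X : vfield R d) x :
  U x -> 'd Phi x (X x) = pushfield X (Phi x).
Proof. by have [_ _ _ _ [h _]] := dPhi; move=> Ux; rewrite /pushfield h. Qed.

Lemma vf_pushforwardE X f y : smooth_on U' f -> U' y ->
  vf_pushforward Phi Psi X f y = vf_act (pushfield X) f y.
Proof.
move=> fs U'y; have [df _] := fs 1%N.
have dfy : differentiable f (Phi (Psi y)) by rewrite PhiK//; exact: df.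
have dPsi := differentiableP (Phi_diff (PsiU U'y)).
have h := is_diff_comp dPsi (differentiableP dfy).
apply: etrans (is_diff_deriveE (X (Psi y)) h) _.
by rewrite /= PhiK// /vf_act deriveE//; exact: df.
Qed.

(** Two fields which agree as derivations agree on the coordinate functions, and
    these are their coefficients. *)
Lemma eq_vf_pushforwardP X Y : eq_vf_on U' (vf_pushforward Phi Psi X) Y <->
  forall y, U' y -> pushfield X y = Y y.
Proof.
split=> [h y U'y|h f fs y U'y]; last by rewrite vf_pushforwardE// /vf_act h.
apply/rowP => i; have sf := smooth_coord i U'.
have := h _ sf y U'y; rewrite vf_pushforwardE//.
have e u : 'D_u (fun v : V => v 0 i) y = u 0 i.
  exact: (is_diff_deriveE u (is_diff_coord i (is_diff_id y))).
by rewrite /vf_act !e.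
Qed.

Lemma vf_act_coord X j y : U' y ->
  (vf_act X (fun x => Phi x 0 j) \o Psi) y = pushfield X y 0 j.
Proof.
move=> U'y.
have dPsi := differentiableP (Phi_diff (PsiU U'y)).
exact: (is_diff_deriveE _ (is_diff_coord j dPsi)).
Qed.

Lemma smooth_pushfield (X : vfield R d) :
  smooth_on U X -> smooth_on U' (pushfield X).
Proof.
move=> sX n; have [sPhi sPsi _ _ _] := dPhi.
apply: (Cn_on_ext (f := fun y => \sum_(i < d)
   X (Psi y) 0 i *: 'D_(basis_vec R i) Phi (Psi y))) => // [y U'y|].
  rewrite /pushfield [RHS]linear_rowE; apply: eq_bigr => i _.
  by rewrite deriveE//; exact/Phi_diff/PsiU.
apply: Cn_on_sum => // i _; apply: Cn_on_scale => //.
  by apply: Cn_on_coord => //; exact: (Cn_on_comp oU' PsiU (sPsi n) (sX n)).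
have [_ D] := sPhi n.+1.
exact: (Cn_on_comp oU' PsiU (sPsi n) (D (basis_vec R i))).
Qed.

Lemma pushfield_bracket X Y y : smooth_on U X -> smooth_on U Y -> U' y ->
  pushfield (vf_bracket X Y) y = vf_bracket (pushfield X) (pushfield Y) y.
Proof.
move=> sX sY U'y; have [sPhi _ _ _ _] := dPhi.
have dP (Z : vfield R d) :
    smooth_on U Z -> differentiable (pushfield Z) (Phi (Psi y)).
  move=> sZ; have [h _] := smooth_pushfield sZ 1%N.
  by rewrite PhiK//; exact: h.
have dZ (Z : vfield R d) : smooth_on U Z -> differentiable Z (Psi y).
  by move=> sZ; have [h _] := sZ 1%N; exact/h/PsiU.
have := vf_bracket_related oU (PsiU U'y) (sPhi 2)
  (dZ X sX) (dZ Y sY) (dP X sX) (dP Y sY)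
  (pushfield_related X) (pushfield_related Y).
by rewrite PhiK.
Qed.

Variable G : stratified_group R d.

(* For a fixed n these v form a subspace; together they behave like a filtered
   Lie algebra. *)
Let pushes_into n v :=
  forall y, U' y -> pushfield (left_inv G v) y \in std_filtration G n y.

Let pushes_intoD n a u v :
  pushes_into n u -> pushes_into n v -> pushes_into n (a *: u + v).
Proof.
move=> hu hv y U'y; rewrite /pushfield left_invD left_invZ linearP.
by rewrite rpredD ?rpredZ//; [exact: hu|exact: hv].
Qed.

Let pushes_into0 n : pushes_into n 0.
Proof.
move=> y U'y; rewrite /pushfield -(scale0r (0 : V)) left_invZ scale0r linear0.
exact: mem0v.
Qed.

Let pushes_into_bracket a b v w : pushes_into a v -> pushes_into b w ->
  pushes_into (a + b) (lie_bracket G v w).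
Proof.
move=> Sv Sw y U'y.
have sl u : smooth_on U (left_inv G u).
  by move=> n; apply: (Cn_on_subset (V := setT)) => //; exact: smooth_left_inv.
have -> : left_inv G (lie_bracket G v w) =
    vf_bracket (left_inv G v) (left_inv G w).
  by apply/funext => x; rewrite vf_bracket_left_inv.
rewrite pushfield_bracket//.
have dP u : differentiable (pushfield (left_inv G u)) y.
  by have [h _] := smooth_pushfield (sl u) 1%N; exact: h.
exact: std_filtration_bracket oU' U'y (dP v) (dP w) Sv Sw.
Qed.

Let layer_proj n (v : V) : V :=
  \row_j (if wt G j == n then v 0 j else 0).

(** The vectors v whose component of each weight n satisfies pushes_into n form
    a subspace which contains the first layer and is closed under brackets,
    since the bracket of components of weights a and b has weight a + b. As the
    first layer generates, this is the whole Lie algebra. *)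
Lemma layer_pushfield :
  (forall x v, U x -> v \in layer_at G 1 x ->
     'd Phi x v \in layer_at G 1 (Phi x)) ->
  forall n v, v \in graded_layer R (wt G) n -> pushes_into n v.
Proof.
move=> hor.
have projP n v : layer_proj n v \in graded_layer R (wt G) n.
  by apply/mem_layer => j /negbTE jn; rewrite mxE jn.
have proj_id n v : v \in graded_layer R (wt G) n -> layer_proj n v = v.
  by move=> /mem_layer h; apply/rowP => j; rewrite mxE; case: eqP => // /eqP /h.
have proj_neq n k v :
    n != k -> v \in graded_layer R (wt G) n -> layer_proj k v = 0.
  move=> nk /mem_layer h; apply/rowP => j; rewrite !mxE; case: eqP => // jk.
  by apply: h; rewrite jk eq_sym.
pose P v := forall n, pushes_into n (layer_proj n v).
have projD n a u v :
    layer_proj n (a *: u + v) = a *: layer_proj n u + layer_proj n v.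
  by apply/rowP => j; rewrite !mxE; case: ifP => // _; rewrite mulr0 addr0.
have P0 : P 0.
  move=> n; have -> : layer_proj n 0 = 0; last exact: pushes_into0.
  by apply/rowP => j; rewrite !mxE if_same.
have PD a u v : P u -> P v -> P (a *: u + v).
  by move=> Pu Pv n; rewrite projD; exact: pushes_intoD.
have [W WP] := exists_vspace P0 PD.
have Pgr n v : v \in graded_layer R (wt G) n -> pushes_into n v -> P v.
  move=> vn Sv k; have [<-|nk] := eqVneq n k; first by rewrite proj_id.
  by rewrite (proj_neq _ _ _ nk vn); exact: pushes_into0.
(* One more than the largest weight, so that the components below N sum to v. *)
pose N := (\max_(j < d) wt G j).+1.
have decomp v : v = \sum_(n < N) layer_proj n v.
  apply/rowP => j; rewrite summxE.
  have jN : (wt G j < N)%N by rewrite ltnS leq_bigmax.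
  rewrite (bigD1 (Ordinal jN))//= big1 ?addr0 => [|n nj].
    by rewrite mxE eqxx.
  by rewrite mxE; case: eqP => // e; case/eqP: nj; apply: val_inj.
have WT : W = fullv.
  apply: (layer1_generates (s := G)).
    apply/subvP => v v1; apply/WP/(Pgr 1%N) => // y U'y.
    rewrite std_filtration1 /pushfield -[X in layer_at _ _ X](PhiK U'y).
    by apply: hor; [exact: PsiU|exact: memv_img].
  move=> v w /WP Pv /WP Pw; apply/WP.
  rewrite (decomp v) (decomp w) lie_bracket_sum.
  have Psum (F : 'I_N -> V) : (forall n, P (F n)) -> P (\sum_(n < N) F n).
    move=> PF; apply: (big_ind P) => // u u' Pu Pu'.
    by rewrite -(scale1r u); exact: PD.
  apply: (Psum) => a; apply: (Psum) => b; apply: (Pgr (a + b)%N).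
    exact: layer_bracket.
  exact: pushes_into_bracket.
move=> n v vn; rewrite -(proj_id _ _ vn).
by have /WP : v \in W by rewrite WT memvf.
Qed.

(** In the expansion along the Z_j of a vector of H^n only those of weight at
    most n occur, and each of these is sent into the step of the filtration
    given by its weight. *)
Lemma horizontal_filtered :
  (forall x v, U x -> v \in layer_at G 1 x ->
     'd Phi x v \in layer_at G 1 (Phi x)) ->
  filtered_map (std_filtration G) (std_filtration G) U Phi.
Proof.
move=> hor n x Ux; apply/subvP => _ /memv_imgP[u /mem_std_filtration un ->].
have -> : tangent_map Phi x u = 'd Phi x u by rewrite /tangent_map lfunE.
rewrite (Zfield_expand G x u) linear_sum.
apply: memv_suml => j _; rewrite linearZ /=.
have [jn|nj] := ltnP n (wt G j); first by rewrite un// scale0r mem0v.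
apply: memvZ; rewrite pushfield_related//.
have [_ _ UU' _ _] := dPhi.
have /mem_std_filtration h :=
  layer_pushfield hor (basis_vec_layer G j) (UU' x Ux).
by apply/mem_std_filtration => k nk; apply/h/(leq_ltn_trans nj).
Qed.

End Pushforward.

(** * The equivalences *)

(* In the last item, 'J Phi x acts on row vectors from the right:
   v *m 'J Phi x is the transpose of J_Phi(x) applied to the column of v. *)
Theorem theorem1p26 (R : realType) (d : nat) (G : stratified_group R d)
    (Omega Omega' : set 'rV[R]_d) (Phi Psi : 'rV[R]_d -> 'rV[R]_d)
    (Omega_open : open Omega) (Omega'_open : open Omega')
    (Phi_diffeo : diffeomorphism Omega Omega' Phi Psi) :
  [<-> filtered_map (std_filtration G) (std_filtration G) Omega Phi;
       forall x, Omega x ->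
         (tangent_map Phi x @: layer_at G 1 x <= layer_at G 1 (Phi x))%VS;
       forall k : 'I_d, horizontal G k ->
         exists2 Y : vfield R d, is_layer1_section G Omega' Y &
           eq_vf_on Omega' (vf_pushforward Phi Psi (Zfield G k)) Y;
       exists2 p : 'I_d -> 'I_d -> 'rV[R]_d -> R,
         (forall i j, horizontal G i -> horizontal G j ->
            smooth_on Omega' (p i j)) &
         (forall k : 'I_d, horizontal G k ->
            eq_vf_on Omega' (vf_pushforward Phi Psi (Zfield G k))
              (fun y => \sum_(j < d | horizontal G j)
                          p k j y *: Zfield G j y));
       forall k : 'I_d, horizontal G k ->
         eq_vf_on Omega' (vf_pushforward Phi Psi (Zfield G k))
           (fun y => \sum_(j < d | horizontal G j)
              (vf_act (Zfield G k) (fun x => Phi x 0 j) \o Psi) y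
                *: Zfield G j y);
       forall x, Omega x ->
         (fun v : 'rV[R]_d => v *m 'J Phi x) @` Fspace G x
           `<=` Fspace G (Phi x)].
Proof.
have [sPhi sPsi UU' U'U [PhiPsi PsiPhi]] := Phi_diffeo.
have sZ k : smooth_on Omega (Zfield G k).
  by move=> n; apply: (Cn_on_subset (V := setT)) => //; exact: smooth_left_inv.
have pushP := eq_vf_pushforwardP Phi_diffeo.
tfae.
- move=> filt x Ux.
  by have := filt 1%N x Ux; rewrite !std_filtration1.
- move=> hor k hk; exists (pushfield Phi Psi (Zfield G k)); last exact/pushP.
  split; first exact: (smooth_pushfield Omega'_open Phi_diffeo (sZ k)).
  move=> y U'y; have /subvP := hor _ (U'U y U'y); rewrite PsiPhi//; apply.
  have -> : pushfield Phi Psi (Zfield G k) y =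
      tangent_map Phi (Psi y) (Zfield G k (Psi y)).
    by rewrite /tangent_map lfunE.
  by apply: memv_img; have := Zfield_layer G k (Psi y); rewrite (eqP hk).
- move=> sect; exists (fun k j y => pushfield Phi Psi (Zfield G k) y 0 j).
    move=> k j _ _ n; apply: Cn_on_coord => //.
    exact: (smooth_pushfield Omega'_open Phi_diffeo (sZ k)).
  move=> k hk; apply/pushP => y U'y; have [Y [_ Yl] /pushP YE] := sect k hk.
  by apply: layer1_expand; rewrite YE//; exact: Yl.
- move=> [p _ pE] k hk; apply/pushP => y U'y; have /pushP pk := pE k hk.
  have pl : pushfield Phi Psi (Zfield G k) y \in layer_at G 1 y.
    by rewrite pk//; exact: layer1_sum.
  rewrite {1}(layer1_expand pl); apply: eq_bigr => j _.
  by rewrite (vf_act_coord Phi_diffeo).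
- move=> sumE x Ox _ [v /Fspace_layer1 vl <-]; apply/Fspace_layer1.
  rewrite /jacobian mul_rV_lin1 (layer1_expand vl) linear_sum.
  apply: memv_suml => j hj; rewrite linearZ; apply: memvZ.
  have /pushP/(_ _ (UU' x Ox)) Zj := sumE j hj.
  rewrite (pushfield_related Phi_diffeo (Zfield G j) Ox) Zj; exact: layer1_sum.
- move=> FF.
  apply: (horizontal_filtered Omega_open Omega'_open Phi_diffeo) => x v Ox vl.
  apply/Fspace_layer1/(FF x Ox); exists v; first exact/Fspace_layer1.
  by rewrite /jacobian mul_rV_lin1.
Qed.
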